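(* Let $C=\mathbb{R}^2/\langle \tau\rangle$ be the flat cylinder, where $\tau$ is a translation of the plane. Any two (metrical) triangulations of a Euclidean polygon on $C$ with $n\geq 4$ vertices can be transformed into each other by a sequence of flips.
   Context: The flat cylinder carries the quotient metric (distance between orbits is the minimum Euclidean distance between representatives). The segment joining two points is the unique shortest geodesic joining them. A Euclidean polygon is a region homeomorphic to a closed disc whose boundary consists of finitely many geodesic arcs. A diagonal is the segment joining two non-consecutive vertices; it is admissible if contained in the polygon. A triangulation of a polygon is a partition of it into triangular regions (homeomorphic to a disc bounded by three segments) by admissible diagonals pairwise intersecting only at endpoints. A flip replaces the common diagonal $\overline{v_iv_j}$ of two triangles $\{v_i,v_j,v_k\},\{v_i,v_j,v_l\}$ of a triangulation by $\overline{v_kv_l}$, provided $\overline{v_kv_l}$ is admissible in the quadrilateral $\{v_i,v_k,v_j,v_l\}$. *)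

(* Defs.v *)
From HB Require Import structures.
From mathcomp Require Import all_boot all_order all_algebra.
From mathcomp Require Import all_classical all_reals topology normedtype.
From Stdlib Require Import Relations.
Set Implicit Arguments. Unset Strict Implicit. Unset Printing Implicit Defensive.
Import Order.TTheory GRing.Theory Num.Theory.
Import numFieldNormedType.Exports.
Local Open Scope classical_set_scope.
Local Open Scope ring_scope.

(* Points of the plane R^2 are pairs (x1, x2) : R * R (product topology =
   Euclidean topology).  The flat cylinder C = R^2 / <tau> is handled through
   lifts: a point of C is represented by any of its lifts in R^2, and the
   orbit of x is { x + k tau | k : int }. *)

Section Geometry.
Variable R : realType.
Notation P2 := (R * R)%type.

Definition shift (tau : P2) (x : P2) (k : int) : P2 :=
  (x.1 + k%:~R * tau.1, x.2 + k%:~R * tau.2).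

Definition sqdist (x y : P2) : R := (x.1 - y.1) ^+ 2 + (x.2 - y.2) ^+ 2.

Definition seg (x y : P2) : set P2 :=
  [set z | exists t : R, 0 <= t <= 1 /\
     z = ((1 - t) * x.1 + t * y.1, (1 - t) * x.2 + t * y.2)].

Definition tri (a b c : P2) : set P2 :=
  [set z | exists u v w : R, [/\ 0 <= u, 0 <= v, 0 <= w, u + v + w = 1 &
     z = (u * a.1 + v * b.1 + w * c.1, u * a.2 + v * b.2 + w * c.2)]].

Definition collinear (a b c : P2) : Prop :=
  (b.1 - a.1) * (c.2 - a.2) - (b.2 - a.2) * (c.1 - a.1) = 0.

(* The planar segment [x, y] projects to THE segment of C (the unique shortest
   geodesic) joining the orbits of x and y: the lift y of the endpoint is the
   unique representative of the orbit of y closest to x. *)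
Definition cyl_segment_lift (tau x y : P2) : Prop :=
  forall k : int, k != 0 -> sqdist x y < sqdist x (shift tau y k).

Definition closed_unit_disc : set P2 := [set x | x.1 ^+ 2 + x.2 ^+ 2 <= 1].

Definition homeomorphic_to_closed_disc (D : set P2) : Prop :=
  exists f g : P2 -> P2,
    [/\ {within closed_unit_disc, continuous f},
        {within D, continuous g},
        (forall x, closed_unit_disc x -> D (f x) /\ g (f x) = x) &
        (forall y, D y -> closed_unit_disc (g y) /\ f (g y) = y)].

Definition frontier (D : set P2) : set P2 := closure D `\` interior D.

Definition succv n (i j : 'I_n) : Prop := (j : nat) = (i.+1 %% n)%N.
Definition consec n (i j : 'I_n) : Prop := succv i j \/ succv j i.

(* A Euclidean polygon on C with vertices v_i = orbit of p i (i < n), in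
   cyclic order along its boundary.  D is a lift of the polygon to R^2:
   the polygon on C is the image of D under the projection, and the projection
   is injective on D (D is disjoint from its nontrivial translates), so the
   polygon is homeomorphic to D.  Its boundary consists of the geodesic arcs
   lifting to the planar segments [p i, p (i+1)]. *)
Definition cyl_polygon (tau : P2) n (p : 'I_n -> P2) (D : set P2) : Prop :=
  injective p /\ [/\
      (forall i j k, succv i j -> succv j k -> ~ collinear (p i) (p j) (p k)),
      (forall i j i' j', succv i j -> succv i' j' -> i <> i' ->
         forall z, seg (p i) (p j) z -> seg (p i') (p j') z ->
           exists a, [/\ a = i \/ a = j, a = i' \/ a = j' & z = p a]),
      homeomorphic_to_closed_disc D,
      frontier D = [set z | exists i j, succv i j /\ seg (p i) (p j) z] &
      (forall k : int, k != 0 -> forall x, D x -> ~ D (shift tau x k))].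

Definition triS n (p : 'I_n -> P2) (t : {set 'I_n}) : set P2 :=
  [set z | exists a b c, t = [set a; b; c]%SET /\ tri (p a) (p b) (p c) z].

(* Admissible diagonal v_a v_b: a, b non-consecutive, the segment of C joining
   v_a and v_b is contained in the polygon (in terms of lifts: its lift from
   p a is [p a, p b] and lies in D). *)
Definition admissible_diag (tau : P2) n (p : 'I_n -> P2) (D : set P2)
  (a b : 'I_n) : Prop :=
  [/\ a <> b, ~ consec a b, cyl_segment_lift tau (p a) (p b) &
      seg (p a) (p b) `<=` D].

Definition triangulation (tau : P2) n (p : 'I_n -> P2) (D : set P2)
  (T : {set {set 'I_n}}) : Prop :=
  [/\
      (forall t, t \in T -> exists a b c, t = [set a; b; c]%SET /\
          ~ collinear (p a) (p b) (p c) /\ [/\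
          cyl_segment_lift tau (p a) (p b),
          cyl_segment_lift tau (p b) (p c),
          cyl_segment_lift tau (p c) (p a) &
          (forall x y, x \in t -> y \in t -> x <> y ->
             consec x y \/ admissible_diag tau p D x y)]),
      (forall t, t \in T -> triS p t `<=` D),
      D `<=` [set z | exists t, t \in T /\ triS p t z],
      (forall t t', t \in T -> t' \in T -> t <> t' ->
         interior (triS p t) `&` interior (triS p t') = set0) &
      (forall t t' a b a' b', t \in T -> t' \in T ->
         a \in t -> b \in t -> a' \in t' -> b' \in t' ->
         a <> b -> a' <> b' -> ~ consec a b -> ~ consec a' b' ->
         [set a; b]%SET <> [set a'; b']%SET ->
         forall z, seg (p a) (p b) z -> seg (p a') (p b') z ->
           exists c, [/\ c \in [set a; b]%SET, c \in [set a'; b']%SET & z = p c])].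

Definition flip (tau : P2) n (p : 'I_n -> P2) (D : set P2)
  (T T' : {set {set 'I_n}}) : Prop :=
  [/\ triangulation tau p D T, triangulation tau p D T' &
      exists i j k l : 'I_n,
        [/\ ~ consec i j, [set i; j; k]%SET \in T, [set i; j; l]%SET \in T & k <> l] /\
        [/\ cyl_segment_lift tau (p k) (p l),
            seg (p k) (p l) `<=` tri (p i) (p j) (p k) `|` tri (p i) (p j) (p l) &
            T' = (T :\ [set i; j; k]%SET :\ [set i; j; l]%SET)
                   :|: [set [set i; k; l]; [set j; k; l]]%SET]].

End Geometry.

(* Main.v *)
Require Import Defs.
From HB Require Import structures.
From mathcomp Require Import all_boot all_order all_algebra.
From mathcomp Require Import all_classical all_reals topology normedtype derive.
From mathcomp Require Import ring lra.
From Stdlib Require Import Relations.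
(** A planar segment is the lift of a shortest geodesic of the cylinder exactly
when its extent along [tau] is less than half of [|tau|]. Lift the vertices by a
generic convex weight [W] dominated by the square of the coordinate along
[tau]. If the edge [ab] of two adjacent triangles [abc], [abd] is not locally
convex for [W], then [acbd] is a strictly convex quadrilateral and [cd] is short
enough to be a geodesic of the cylinder: a long [cd] would span an interval
strictly containing that of [ab], and [ab] would be locally convex. Hence [ab]
can be flipped, and this lowers the integral of the interpolation of [W]. Both
triangulations therefore flip down to locally convex ones. Walking along a
segment in [D] towards a vertex shows that a locally convex triangulation has the
smallest interpolation, so by genericity there is only one. Flips are reversible. *)

Set Implicit Arguments. Unset Strict Implicit. Unset Printing Implicit Defensive.
Import Order.TTheory GRing.Theory Num.Theory.
Import numFieldNormedType.Exports.
Local Open Scope classical_set_scope.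
Local Open Scope ring_scope.

(** * Oriented areas in the plane *)

Section Plane.
Variable R : realType.
Implicit Types (a b c d x y z u : R * R) (s : R).

(** In the plane every strictly convex quadrilateral can be flipped; on the cylinder the new
    diagonal may fail to be a shortest geodesic. The other summands of the weight are scaled by [t]
    and by higher powers of one small [t], so each requirement on the weight becomes the sign or the
    nonvanishing of a polynomial in [t] near 0, and finitely many such requirements hold together.

    A second obstacle is that a triangulation is given only as a set of label triples, with
    conditions on interiors and on diagonals. That the triangle across an inner edge shares the
    whole edge, and that no vertex of the polygon lies elsewhere in a triangle, has to be recovered
    from the topology of [D]. *)

Definition area2 a b c : R := (b.1 - a.1) * (c.2 - a.2) - (b.2 - a.2) * (c.1 - a.1).

Definition step z u s : R * R := (z.1 + s * u.1, z.2 + s * u.2).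
Definition towards z y : R * R := (y.1 - z.1, y.2 - z.2).

Lemma area2_rot a b c : area2 b c a = area2 a b c.
Proof. rewrite /area2; ring. Qed.

Lemma area2_swap a b c : area2 b a c = - area2 a b c.
Proof. rewrite /area2; ring. Qed.

Lemma area2_split a b c x : area2 a b x + area2 b c x + area2 c a x = area2 a b c.
Proof. rewrite /area2; ring. Qed.

Lemma area2_aab a b : area2 a a b = 0.
Proof. rewrite /area2; ring. Qed.

Lemma area2_aba a b : area2 a b a = 0.
Proof. rewrite /area2; ring. Qed.

Lemma area2_baa a b : area2 b a a = 0.
Proof. rewrite /area2; ring. Qed.

Definition area2E := (area2_aab, area2_aba, area2_baa).

Lemma area2_step a b z u s :
  area2 a b (step z u s) = area2 a b z + s * (area2 a b (step z u 1) - area2 a b z).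
Proof. rewrite /area2 /step /=; ring. Qed.

Lemma area2_towards a b z y s :
  area2 a b (step z (towards z y) s) = (1 - s) * area2 a b z + s * area2 a b y.
Proof. rewrite /area2 /step /towards /=; ring. Qed.

(** The barycentric coordinates of [x] are the three areas divided by [area2 a b c]. *)
Lemma triP a b c x : 0 < area2 a b c ->
  tri a b c x <-> [/\ 0 <= area2 a b x, 0 <= area2 b c x & 0 <= area2 c a x].
Proof.
move=> A0; split.
  move=> [u [v [w [u0 v0 w0 uvw ->]]]].
  have E1 : u = 1 - v - w by lra.
  split.
  + have -> : area2 a b (u * a.1 + v * b.1 + w * c.1, u * a.2 + v * b.2 + w * c.2) = w * area2 a b c.
      by rewrite E1 /area2 /=; ring.
    exact: mulr_ge0 w0 (ltW A0).
  + have -> : area2 b c (u * a.1 + v * b.1 + w * c.1, u * a.2 + v * b.2 + w * c.2) = u * area2 a b c.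
      by rewrite E1 /area2 /=; ring.
    exact: mulr_ge0 u0 (ltW A0).
  + have -> : area2 c a (u * a.1 + v * b.1 + w * c.1, u * a.2 + v * b.2 + w * c.2) = v * area2 a b c.
      by rewrite E1 /area2 /=; ring.
    exact: mulr_ge0 v0 (ltW A0).
move=> [h1 h2 h3].
have An : area2 a b c != 0 by rewrite gt_eqF.
exists (area2 b c x / area2 a b c), (area2 c a x / area2 a b c), (area2 a b x / area2 a b c).
split; try exact: divr_ge0 _ (ltW A0).
  by rewrite -!mulrDl addrC addrA area2_split divff.
case: x h1 h2 h3 => x1 x2 _ _ _ /=.
by congr pair; apply: (mulfI An); move: An; rewrite /area2 /= => An; field.
Qed.

Lemma tri_area2_ge0 a b c x y z : tri a b c z ->
  0 <= area2 x y a -> 0 <= area2 x y b -> 0 <= area2 x y c -> 0 <= area2 x y z.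
Proof.
move=> [u [v [w [u0 v0 w0 uvw ->]]]] ha hb hc.
have -> : area2 x y (u * a.1 + v * b.1 + w * c.1, u * a.2 + v * b.2 + w * c.2) =
   u * area2 x y a + v * area2 x y b + w * area2 x y c.
  have E1 : u = 1 - v - w by lra.
  rewrite E1 /area2 /=; ring.
by rewrite !addr_ge0 ?mulr_ge0.
Qed.

Lemma segP x y z : seg x y z <-> exists s, 0 <= s <= 1 /\ z = step x (towards x y) s.
Proof.
split=> -[s [hs ->]]; exists s; split=> //; rewrite /step /towards /=; congr pair; ring.
Qed.

Lemma seg_tri a b c z : seg a b z -> tri a b c z.
Proof.
move=> [s [/andP[s0 s1] ->]]; exists (1 - s), s, 0; split=> //; first by rewrite subr_ge0.
  by ring.
by rewrite !mul0r !addr0.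
Qed.

Lemma seg_sym a b : seg a b `<=` seg b a.
Proof.
move=> z [s [/andP[s0 s1] ->]]; exists (1 - s); split; first by apply/andP; split; lra.
by congr pair; ring.
Qed.

Lemma tri_corner a b c : tri a b c a.
Proof.
by exists 1, 0, 0; split; rewrite ?ler01 ?addr0 // !mul1r !mul0r !addr0; case: a.
Qed.

Lemma tri_rot a b c : tri a b c `<=` tri b c a.
Proof.
move=> z [u [v [w [? ? ? ? ->]]]]; exists v, w, u; split=> //; first by lra.
by congr pair; ring.
Qed.

Lemma tri_swap a b c : tri a b c `<=` tri b a c.
Proof.
move=> z [u [v [w [? ? ? ? ->]]]]; exists v, u, w; split=> //; first by lra.
by congr pair; ring.
Qed.

Lemma area2_corner a b c z : 0 < area2 a b c ->
  area2 a b z = 0 -> area2 b c z = 0 -> z = b.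
Proof.
move=> A0 h1 h2.
have An : area2 a b c != 0 by rewrite gt_eqF.
have h3 : area2 c a z = area2 a b c by rewrite -(area2_split a b c z) h1 h2; ring.
case: z h1 h2 h3 => z1 z2 h1 h2 h3; case: b h1 h2 h3 An {A0} => b1 b2.
rewrite /area2 /= => h1 h2 h3 An.
(* [E1] and [E2] are Cramer's rule for the two linear equations that say that [z] is on the lines
   [ab] and [bc]. *)
have E1 : (z1 - b1) * ((b1 - a.1) * (c.2 - a.2) - (b2 - a.2) * (c.1 - a.1)) =
  (c.1 - b1) * ((b1 - a.1) * (z2 - a.2) - (b2 - a.2) * (z1 - a.1))
   + (a.1 - b1) * ((c.1 - b1) * (z2 - b2) - (c.2 - b2) * (z1 - b1)) by ring.
have E2 : (z2 - b2) * ((b1 - a.1) * (c.2 - a.2) - (b2 - a.2) * (c.1 - a.1)) =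
  (c.2 - b2) * ((b1 - a.1) * (z2 - a.2) - (b2 - a.2) * (z1 - a.1))
   + (a.2 - b2) * ((c.1 - b1) * (z2 - b2) - (c.2 - b2) * (z1 - b1)) by ring.
move: E1 E2; rewrite h1 h2 !mulr0 addr0 => /eqP + /eqP.
rewrite !mulf_eq0 (negPf An) !orbF !subr_eq0 => /eqP -> /eqP ->; by [].
Qed.

Lemma tri_seg a b c z : 0 < area2 a b c -> tri a b c z -> area2 a b z = 0 -> seg a b z.
Proof.
move=> A0 [u [v [w [u0 v0 w0 uvw zE]]]] h1; have An : area2 a b c != 0 by rewrite gt_eqF.
have w0' : w = 0.
  have : w * area2 a b c = 0.
    rewrite -[RHS]h1 zE /area2 /=; have -> : u = 1 - v - w by lra.
    ring.
  by move/eqP; rewrite mulf_eq0 (negPf An) orbF => /eqP.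
exists v; rewrite zE w0'; split; first by apply/andP; split; lra.
have -> : u = 1 - v by lra.
by rewrite !mul0r !addr0.
Qed.

Lemma open_segP a b c z : 0 < area2 a b c -> area2 a b z = 0 ->
  0 < area2 b c z -> 0 < area2 c a z -> seg a b z.
Proof.
move=> A0 h1 h2 h3; apply: (tri_seg A0) => //; apply/triP => //.
by rewrite h1 lexx; split=> //; apply: ltW.
Qed.

Lemma area2_seg a b z : seg a b z -> area2 a b z = 0.
Proof. by move=> [s [_ ->]]; rewrite /area2 /=; ring. Qed.

(** If [z] divides [ab] in some ratio, it divides the areas of [abc] and of [bad] in that same
    ratio. This carries the position of [z] on an edge from one triangle to the triangle across
    it. *)
Lemma area2_across a b c d z : area2 a b z = 0 ->
  area2 a b c * area2 a d z = area2 c a z * area2 b a d /\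
  area2 a b c * area2 d b z = area2 b c z * area2 b a d.
Proof.
move=> z0; split; apply/eqP; rewrite -subr_eq0.
  by rewrite (_ : _ - _ = - area2 a b z * area2 a c d); [rewrite z0 oppr0 mul0r|rewrite /area2; ring].
by rewrite (_ : _ - _ = area2 a b z * area2 b c d); [rewrite z0 mul0r|rewrite /area2; ring].
Qed.

Lemma exists_area2_gt0 a b : a <> b -> exists c, 0 < area2 a b c.
Proof.
(* [a] plus the quarter turn of [b - a]: the area is the squared length of [b - a]. *)
move=> ab; exists (a.1 - (b.2 - a.2), a.2 + (b.1 - a.1)).
have -> : area2 a b (a.1 - (b.2 - a.2), a.2 + (b.1 - a.1)) =
  (b.1 - a.1) ^+ 2 + (b.2 - a.2) ^+ 2 by rewrite /area2 /=; ring.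
rewrite lt0r addr_ge0 ?sqr_ge0 // andbT; apply: contra_notN ab.
rewrite paddr_eq0 ?sqr_ge0 // !sqrf_eq0 !subr_eq0 => /andP[/eqP + /eqP].
by case: a b => [? ?] [? ?] /= -> ->.
Qed.

Lemma area2_continuous a b : continuous (area2 a b : R * R -> R).
Proof.
move=> x; rewrite /area2.
apply: cvgB; apply: cvgM; try exact: cvg_cst; apply: cvgB; try exact: cvg_cst.
  exact: cvg_snd.
exact: cvg_fst.
Qed.

Lemma near_area2_gt0 a b z : 0 < area2 a b z -> \forall x \near z, 0 < area2 a b x.
Proof. by move=> h; have := @area2_continuous a b z => /cvgr_gt; apply. Qed.

Lemma tri_nbhs a b c z : 0 < area2 a b c ->
  0 < area2 a b z -> 0 < area2 b c z -> 0 < area2 c a z ->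
  \forall x \near z, [/\ 0 < area2 a b x, 0 < area2 b c x & 0 < area2 c a x].
Proof.
by move=> A0 h1 h2 h3; near=> x; split; near: x; exact: near_area2_gt0.
Unshelve. all: by end_near. Qed.

Lemma step0 z u : step z u 0 = z.
Proof. by case: z => z1 z2; rewrite /step /= !mul0r !addr0. Qed.

Lemma affine_near (z u : R) (A : set R) : nbhs z A ->
  \forall s \near 0^'+, A (z + s * u).
Proof.
have : (fun s => z + s * u) @ 0^'+ --> z.
  rewrite -[X in _ --> X]addr0 -{2}(mul0r u); apply: cvg_at_right_filter.
  by apply: cvgD; [exact: cvg_cst|apply: cvgM; [exact: cvg_id|exact: cvg_cst]].
exact.
Qed.

Lemma step_near z u (A : set (R * R)) : (\forall x \near z, A x) ->
  \forall s \near 0^'+, A (step z u s).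
Proof.
case: z u => z1 z2 [u1 u2] [[P Q] /= [nP nQ] PQA].
near=> s; apply: PQA; split; rewrite /step /=; near: s; exact: affine_near.
Unshelve. all: by end_near. Qed.

(** Factor out ['X], which does not vanish for [s > 0], until the value at 0 is nonzero; then
    continuity suffices. *)
Lemma poly_near_neq0 (q : {poly R}) : q != 0 -> \forall s \near 0^'+, q.[s] != 0.
Proof.
have Hx (q' : {poly R}) : q'.[0] != 0 -> \forall s \near 0^'+, q'.[s] != 0.
  move=> r0; have : q'.[s] @[s --> 0^'+] --> q'.[0].
    by apply: cvg_at_right_filter; exact: continuous_horner.
  by move=> /cvgr_neq0; exact.
move: {2}(size q) (leqnn (size q)) => m; elim: m q => [|m IH] q.
  by rewrite leqn0 size_poly_eq0 => /eqP ->; rewrite eqxx.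
move=> sq q0; have [r0|/Hx//] := eqVneq q.[0] 0.
have /factor_theorem [r qE] : root q 0 by rewrite /root r0.
rewrite subr0 in qE; rewrite qE in q0 sq *.
have r1 : r != 0 by apply: contraNneq q0 => ->; rewrite mul0r.
rewrite size_mulX // in sq.
have := IH _ sq r1 => IHr; near=> s.
rewrite hornerM hornerX mulf_neq0 //; first by near: s.
Unshelve. all: by end_near. Qed.
End Plane.

(** * Points in general position *)

Section Generic.
Variable R : realType.
Implicit Types (x z : R * R).

Lemma quadratic_neq0 (c0 c1 c2 : R) : (c1 != 0) || (c2 != 0) ->
  \forall s \near 0^'+, c0 + s * c1 + s ^+ 2 * c2 != 0.
Proof.
move=> h; pose q : {poly R} := c0%:P + c1 *: 'X + c2 *: 'X^2.
have q0 : q != 0.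
  case/orP: h => h; apply: contraNneq h.
    by move=> /(congr1 (fun r : {poly R} => r`_1)); rewrite /q !coefE /= => E; apply/eqP; lra.
  by move=> /(congr1 (fun r : {poly R} => r`_2)); rewrite /q !coefE /= => E; apply/eqP; lra.
have := poly_near_neq0 q0 => H; near=> s.
have -> : c0 + s * c1 + s ^+ 2 * c2 = q.[s].
  by rewrite /q !hornerE /=; ring.
by near: s.
Unshelve. all: by end_near. Qed.

Variables (n : nat) (p : 'I_n -> R * R).

Definition off_lines x := forall i j, i != j -> area2 (p i) (p j) x != 0.

(** Leave [x] along the parabola with offset [(s, s * s)]. On it the equation of a line is a
    polynomial in [s] whose coefficients of degree 1 and 2 are the coordinates of a normal vector,
    hence not both zero, even if the line passes through [x]. *)
Lemma exists_off_lines x (U : set (R * R)) : injective p -> nbhs x U ->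
  exists2 y, U y & off_lines y.
Proof.
move=> pI; case: x => x1 x2 [[P Q] /= [nP nQ] PQU].
have H : \forall s \near 0^'+, forall i j, i != j ->
    area2 (p i) (p j) (x1 + s * 1, x2 + s * s) != 0.
  apply: filter_forall => i; apply: filter_forall => j.
  have [->|ij] := eqVneq i j; first by apply: nearW.
  have : ((p i).2 - (p j).2 != 0) || ((p j).1 - (p i).1 != 0).
    rewrite -negb_and; apply: contra_neqN ij => /andP[]; rewrite !subr_eq0 => /eqP h2 /eqP h1.
    by apply: pI; move: h1 h2; case: (p i) (p j) => [? ?] [? ?] /= -> ->.
  move=> /(quadratic_neq0 (area2 (p i) (p j) (x1, x2))); apply: filterS => s + _.
  by congr (_ != _); rewrite /area2 /=; ring.
have Q2 : \forall s \near 0^'+, Q (x2 + s * s).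
  have : (fun s => x2 + s * s) @ (0:R)^'+ --> x2.
    rewrite -[X in _ --> X]addr0 -{2}(mul0r (0:R)); apply: cvg_at_right_filter.
    by apply: cvgD; [exact: cvg_cst|apply: cvgM; exact: cvg_id].
  exact.
have P1 := affine_near 1 nP.
have /filter_ex [s [Ps Qs Hs]] : \forall s \near 0^'+, [/\ P (x1 + s * 1), Q (x2 + s * s) &
   forall i j, i != j -> area2 (p i) (p j) (x1 + s * 1, x2 + s * s) != 0].
  by near=> s; split; near: s.
by exists (x1 + s * 1, x2 + s * s); [apply: PQU|].
Unshelve. all: by end_near. Qed.

End Generic.

(** * A generic convex weight *)

Section Weight.
Variable R : realType.
Implicit Types (t : R) (C : {poly R}).

Lemma near_poly_gt0 (q : {poly R}) : 0 < q.[0] -> \forall t \near 0^'+, 0 < q.[t].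
Proof.
move=> q0; have : q.[t] @[t --> 0^'+] --> q.[0].
  by apply: cvg_at_right_filter; exact: continuous_horner.
by move=> /cvgr_gt; apply.
Qed.

Definition pencil (A B : R) C : {poly R} := A%:P + B *: 'X + 'X^2 * C.

Lemma near_pencil_gt0 (A B : R) C : 0 < A -> \forall t \near 0^'+, 0 < (pencil A B C).[t].
Proof. by move=> A0; apply: near_poly_gt0; rewrite /pencil !hornerE; lra. Qed.

(** For [t <= 1] the value is at least [t] times that of [A + B + 'X * C], which is positive near
    0. *)
Lemma near_pencil_gt0_semi (A B : R) C : 0 <= A -> 0 <= B -> 0 < A + B ->
  \forall t \near 0^'+, 0 < (pencil A B C).[t].
Proof.
move=> A0 B0 AB.
have H : \forall t \near 0^'+, 0 < ((A + B)%:P + 'X * C).[t].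
  by apply: near_poly_gt0; rewrite !hornerE /=; lra.
near=> t; have t0 : 0 < t by [].
have t1 : t <= 1 by near: t; apply: nbhs_right_le.
have : 0 < t * ((A + B)%:P + 'X * C).[t] by apply: mulr_gt0 => //; near: t.
have : 0 <= A * (1 - t) by rewrite mulr_ge0 // subr_ge0.
rewrite /pencil !hornerE; nra.
Unshelve. all: by end_near. Qed.

Variables (n : nat) (p : 'I_n -> R * R).

(* The height of W d above the plane interpolating W over abc, scaled by the
   signed area of abc. *)
Definition excess (W : 'I_n -> R) (a b c d : 'I_n) : R :=
  area2 (p a) (p b) (p c) * W d -
  (area2 (p b) (p c) (p d) * W a + area2 (p c) (p a) (p d) * W b
   + area2 (p a) (p b) (p d) * W c).

Variable tau : R * R.

(** [height] and [depth] are the coordinates along and across [tau], both multiplied by the length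
    of [tau]; this avoids square roots here and in [short]. *)
Definition height (x : R * R) : R := x.1 * tau.1 + x.2 * tau.2.
Definition depth (x : R * R) : R := x.1 * tau.2 - x.2 * tau.1.

Definition short (x y : R * R) : Prop :=
  `|2 * (height x - height y)| < tau.1 ^+ 2 + tau.2 ^+ 2.

Lemma short_sym x y : short x y -> short y x.
Proof. by rewrite /short -normrN -mulrN opprB. Qed.

Lemma normsq_gt0 : tau <> (0, 0) -> 0 < tau.1 ^+ 2 + tau.2 ^+ 2.
Proof.
case: tau => t1 t2 /= h; rewrite lt0r addr_ge0 ?sqr_ge0 // andbT.
by apply: contra_notN h; rewrite paddr_eq0 ?sqr_ge0 // !sqrf_eq0 => /andP[/eqP -> /eqP ->].
Qed.

(** Moving [y] by [k] periods changes the squared distance by [k ^+ 2 * L - k * g], with [L] the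
    squared length of [tau] and [g] twice the height difference; the component across [tau] cancels.
    The cases [k = 1] and [k = -1] give the bound on [g], and they imply all others. *)
Lemma cyl_segment_liftP x y : tau <> (0, 0) -> cyl_segment_lift tau x y <-> short x y.
Proof.
move=> /normsq_gt0 L0.
have E (k : int) : sqdist x (Defs.shift tau y k) - sqdist x y =
    k%:~R ^+ 2 * (tau.1 ^+ 2 + tau.2 ^+ 2) - k%:~R * (2 * (height x - height y)).
  by rewrite /sqdist /Defs.shift /height /=; ring.
rewrite /short; set L := _ + _ in L0 E *; set g := 2 * _ in E *.
split=> [h|/ltr_normlP[h1 h2] k k0].
  have := h 1 isT; rewrite -subr_gt0 E mulr1z => g1.
  have := h (-1) isT; rewrite -subr_gt0 E mulrN1z => g2.
  by apply/ltr_normlP; split; lra.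
rewrite -subr_gt0 E.
have k1 : 1 <= `|k%:~R : R| by rewrite -intr_norm -[1]/(1%:~R) ler_int -gtz0_ge1 normr_gt0.
move: (k%:~R : R) k1 => K; have [kp|kn] := lerP 0 K.
  rewrite ger0_norm // => k1; have h3 : L <= K * L by rewrite ler_peMl // ltW.
  have : 0 < K * (K * L - g) by apply: mulr_gt0; lra.
  by rewrite mulrBr mulrA -expr2.
rewrite ltr0_norm // => k1; have h3 : L <= - K * L by rewrite ler_peMl // ltW.
have : 0 < - K * (- K * L + g) by apply: mulr_gt0; lra.
by rewrite (_ : - K * _ = K ^+ 2 * L - K * g) //; ring.
Qed.

(* The leading term makes long diagonals unattractive; the second makes the
   form strictly convex; the third makes the weight generic. *)
Definition weight t (v : 'I_n) : R :=
  height (p v) ^+ 2 + t * depth (p v) ^+ 2 + t ^+ 2 * t ^+ v.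

Let tail (a b c d : 'I_n) : {poly R} :=
  area2 (p a) (p b) (p c) *: 'X^d - (area2 (p b) (p c) (p d) *: 'X^a
  + area2 (p c) (p a) (p d) *: 'X^b + area2 (p a) (p b) (p d) *: 'X^c).

Lemma excess_weight t a b c d : excess (weight t) a b c d =
  (pencil (excess (fun v => height (p v) ^+ 2) a b c d)
          (excess (fun v => depth (p v) ^+ 2) a b c d) (tail a b c d)).[t].
Proof. by rewrite /excess /pencil /tail /weight !hornerE /=; ring. Qed.

(** The coefficient of degree [d + 2] is [area2 (p a) (p b) (p c)]: the other three vertices
    contribute to other degrees, and the factor [t ^+ 2] keeps the generic term clear of the
    constant and linear ones. *)
Lemma excess_weight_neq0 a b c d : area2 (p a) (p b) (p c) != 0 ->
  d != a -> d != b -> d != c -> \forall t \near 0^'+, excess (weight t) a b c d != 0.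
Proof.
move=> S0 da db dc; under eq_near do rewrite excess_weight; apply: poly_near_neq0.
apply: contraNneq S0 => /(congr1 (fun r : {poly R} => r`_d.+2)).
rewrite /pencil coef0 !coefD coefC coefZ coefX /= mulr0 !add0r coefXnM /= subn2 /=.
rewrite /tail coefB !coefD !coefZ !coefXn eqxx.
by rewrite !(inj_eq val_inj) (negPf da) (negPf db) (negPf dc) !mulr0 !addr0 subr0 mulr1 => ->.
Qed.

(** The excess ignores affine functions, so the squares may be centred at [wb]. This removes the
    coefficient [be]. *)
Lemma convex_excess (al be ga S wa wb wc wd : R) :
  al + be + ga = S -> al * wa + be * wb + ga * wc = S * wd ->
  S * wd ^+ 2 - (al * wa ^+ 2 + be * wb ^+ 2 + ga * wc ^+ 2) =
  S * (wd - wb) ^+ 2 - al * (wa - wb) ^+ 2 - ga * (wc - wb) ^+ 2.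
Proof.
move=> h1 h2.
have -> : be = S - al - ga by lra.
have h3 : S * wd - (al * wa + (S - al - ga) * wb + ga * wc) = 0.
  by rewrite -h2 (_ : S - al - ga = be); [ring|lra].
apply/eqP; rewrite -subr_eq0; apply/eqP.
by transitivity (2 * wb * (S * wd - (al * wa + (S - al - ga) * wb + ga * wc)));
  [ring|rewrite h3 mulr0].
Qed.

Lemma area2_height a b c d : area2 b c d * height a + area2 c a d * height b
  + area2 a b d * height c = area2 a b c * height d.
Proof. rewrite /area2 /height; ring. Qed.

Lemma area2_depth a b c d : area2 b c d * depth a + area2 c a d * depth b
  + area2 a b d * depth c = area2 a b c * depth d.
Proof. rewrite /area2 /depth; ring. Qed.

Lemma area2_sum a b c d : area2 b c d + area2 c a d + area2 a b d = area2 a b c :> R.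
Proof. rewrite /area2; ring. Qed.

Lemma height_depth x y : (height x - height y) ^+ 2 + (depth x - depth y) ^+ 2 =
  (tau.1 ^+ 2 + tau.2 ^+ 2) * ((x.1 - y.1) ^+ 2 + (x.2 - y.2) ^+ 2).
Proof. rewrite /height /depth; ring. Qed.

Lemma sqr_diff_gt0 (x y : R * R) : x <> y -> 0 < (x.1 - y.1) ^+ 2 + (x.2 - y.2) ^+ 2.
Proof.
case: x y => x1 x2 [y1 y2] /= h; rewrite lt0r addr_ge0 ?sqr_ge0 // andbT.
by apply: contra_notN h; rewrite paddr_eq0 ?sqr_ge0 // !sqrf_eq0 !subr_eq0 => /andP[/eqP -> /eqP ->].
Qed.

Lemma near_cone_gt0 (al be ga S ha hb hc hd ka kb kc kd : R) C :
  0 < S -> ga < 0 -> al <= 0 -> al + be + ga = S ->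
  al * ha + be * hb + ga * hc = S * hd -> al * ka + be * kb + ga * kc = S * kd ->
  0 < (hc - hb) ^+ 2 + (kc - kb) ^+ 2 ->
  \forall t \near 0^'+, 0 < (pencil
    (S * hd ^+ 2 - (al * ha ^+ 2 + be * hb ^+ 2 + ga * hc ^+ 2))
    (S * kd ^+ 2 - (al * ka ^+ 2 + be * kb ^+ 2 + ga * kc ^+ 2)) C).[t].
Proof.
move=> S0 ga0 al0 sumS hE kE D.
rewrite (convex_excess sumS hE) (convex_excess sumS kE).
have H (x y z : R) : 0 <= S * x ^+ 2 - al * y ^+ 2 - ga * z ^+ 2.
  by have := sqr_ge0 x; have := sqr_ge0 y; have := sqr_ge0 z; nra.
apply: near_pencil_gt0_semi => //.
move: D; have := H (hd - hb) (ha - hb) 0; have := H (kd - kb) (ka - kb) 0.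
rewrite expr0n /=; nra.
Qed.

Hypothesis tau0 : tau <> (0, 0).

Lemma height_depth_gt0 x y : x <> y ->
  0 < (height x - height y) ^+ 2 + (depth x - depth y) ^+ 2.
Proof. by move=> h; rewrite height_depth mulr_gt0 ?normsq_gt0 // sqr_diff_gt0. Qed.

(** Jensen's inequality: the quadrilateral is not strictly convex at [b] (or [a]), so that vertex is
    a convex combination of the other three points, with positive weights on [c] and [d]. The height
    and depth terms are then both nonnegative, and not both zero. *)
Lemma excess_weight_cone a b c d : 0 < area2 (p a) (p b) (p c) ->
  area2 (p a) (p b) (p d) < 0 ->
  area2 (p b) (p c) (p d) <= 0 \/ area2 (p c) (p a) (p d) <= 0 ->
  \forall t \near 0^'+, 0 < excess (weight t) a b c d.
Proof.
move=> S0 ga [h|h]; under eq_near do rewrite excess_weight.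
  apply: near_cone_gt0; rewrite ?area2_sum ?area2_height ?area2_depth //.
  by apply: height_depth_gt0 => E; move: S0; rewrite E !area2E ltxx.
rewrite /excess ![area2 (p b) _ _ * _ + area2 (p c) _ _ * _]addrC.
apply: near_cone_gt0; rewrite // ?[area2 (p c) _ _ + _]addrC
  ?[area2 (p c) _ _ * _ + _]addrC ?area2_sum ?area2_height ?area2_depth //.
by apply: height_depth_gt0 => E; move: S0; rewrite E !area2E ltxx.
Qed.

(* The long chord cd spans, along tau, an interval that strictly contains the
   interval spanned by ab, so the parabola is lower over ab. *)
Lemma excess_weight_long a b c d : 0 < area2 (p a) (p b) (p c) ->
  area2 (p a) (p b) (p d) < 0 ->
  0 < area2 (p b) (p c) (p d) -> 0 < area2 (p c) (p a) (p d) ->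
  short (p a) (p c) -> short (p a) (p d) -> short (p b) (p c) -> short (p b) (p d) ->
  ~ short (p c) (p d) -> \forall t \near 0^'+, 0 < excess (weight t) a b c d.
Proof.
move=> S0 ga al be.
have := area2_height (p a) (p b) (p c) (p d); have := area2_sum (p a) (p b) (p c) (p d).
under eq_near do rewrite excess_weight.
rewrite /short => sumS hE hac had hbc hbd /negP; rewrite -leNgt => hcd.
apply: near_pencil_gt0; move: hac had hbc hbd hcd S0 ga al be sumS hE.
rewrite /excess; set L := tau.1 ^+ 2 + tau.2 ^+ 2.
move: (height (p a)) (height (p b)) (height (p c)) (height (p d)) => ha hb hc hd.
move: (area2 (p a) (p b) (p c)) (area2 (p b) (p c) (p d)) => S al.
move: (area2 (p c) (p a) (p d)) (area2 (p a) (p b) (p d)) => be ga.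
move=> /ltr_normlP[a1 a2] /ltr_normlP[a3 a4] /ltr_normlP[b1 b2] /ltr_normlP[b3 b4].
move=> hcd S0 ga0 al0 be0 sumS hE.
(* The heights of [c] and [d] differ by at least [L / 2], those along each side by less, so [ha] and
   [hb] lie strictly between [hc] and [hd]. *)
have [ma mb] : (ha - hc) * (ha - hd) < 0 /\ (hb - hc) * (hb - hd) < 0.
  have [h|h] := lerP 0 (2 * (hc - hd)).
    by rewrite ger0_norm // in hcd; split; rewrite nmulr_rlt0; lra.
  by rewrite ltr0_norm // in hcd; split; rewrite pmulr_rlt0; lra.
have := mulr_gt0 al0 (_ : 0 < - ((ha - hc) * (ha - hd))).
have := mulr_gt0 be0 (_ : 0 < - ((hb - hc) * (hb - hd))).
rewrite !oppr_gt0 => /(_ mb) h1 /(_ ma) h2.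
have {}hE : al * ha + be * hb + ga * hc - (al + be + ga) * hd = 0 by rewrite hE -sumS subrr.
rewrite -sumS.
(* Subtract from the square the affine function that agrees with it at [hc] and [hd], of slope
   [hc + hd]. What remains is [(h - hc) * (h - hd)], zero at [c] and [d] and negative at [a] and
   [b]. *)
have h3 : (hc + hd) * (al * ha + be * hb + ga * hc - (al + be + ga) * hd) = 0.
  by rewrite hE mulr0.
nra.
Qed.

Lemma exists_weight : exists W : 'I_n -> R, [/\
  (forall a b c d, area2 (p a) (p b) (p c) != 0 ->
     d != a -> d != b -> d != c -> excess W a b c d != 0),
  (forall a b c d, 0 < area2 (p a) (p b) (p c) -> area2 (p a) (p b) (p d) < 0 ->
     area2 (p b) (p c) (p d) <= 0 \/ area2 (p c) (p a) (p d) <= 0 -> 0 < excess W a b c d) &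
  (forall a b c d, 0 < area2 (p a) (p b) (p c) -> area2 (p a) (p b) (p d) < 0 ->
     0 < area2 (p b) (p c) (p d) -> 0 < area2 (p c) (p a) (p d) ->
     short (p a) (p c) -> short (p a) (p d) -> short (p b) (p c) -> short (p b) (p d) ->
     ~ short (p c) (p d) -> 0 < excess W a b c d)].
Proof.
(* The geometric hypotheses do not mention [t], so they can be decided before [t] is made small. *)
have lift (I : Prop) (Q : R -> Prop) : (I -> \forall t \near 0^'+, Q t) ->
    \forall t \near 0^'+, I -> Q t.
  by have [i /(_ i)|i _] := pselect I; [apply: filterS|apply: nearW].
have H : \forall t \near (0:R)^'+, forall a b c d, [/\
  (area2 (p a) (p b) (p c) != 0 /\ [/\ d != a, d != b & d != c] ->
     excess (weight t) a b c d != 0),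
  (0 < area2 (p a) (p b) (p c) /\ area2 (p a) (p b) (p d) < 0 /\
     (area2 (p b) (p c) (p d) <= 0 \/ area2 (p c) (p a) (p d) <= 0) ->
     0 < excess (weight t) a b c d) &
  ([/\ 0 < area2 (p a) (p b) (p c), area2 (p a) (p b) (p d) < 0,
     0 < area2 (p b) (p c) (p d) & 0 < area2 (p c) (p a) (p d)] /\
     [/\ short (p a) (p c), short (p a) (p d), short (p b) (p c), short (p b) (p d) &
     ~ short (p c) (p d)] -> 0 < excess (weight t) a b c d)].
  do 4 (apply: filter_forall => ?).
  near=> t; split; near: t; apply: lift.
  - by move=> [? [? ? ?]]; exact: excess_weight_neq0.
  - by move=> [? [? ?]]; exact: excess_weight_cone.
  - by move=> [[? ? ? ?] [? ? ? ? ?]]; exact: excess_weight_long.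
have [t Ht] := @filter_ex _ ((0:R)^'+) _ _ H; exists (weight t).
split=> a b c d.
- by have [h _ _] := Ht a b c d => ? ? ? ?; apply: h.
- by have [_ h _] := Ht a b c d => ? ? ?; apply: h.
- by have [_ _ h] := Ht a b c d => ? ? ? ? ? ? ? ? ?; apply: h.
Unshelve. all: by end_near. Qed.

End Weight.

(** * Properties that hold at arbitrarily small positive parameters *)

Section Frequently.
Variable R : realType.

(** The dual of being eventually true. Unlike the latter it passes from a finite disjunction to one
    of its members, so a ray that keeps meeting a finite family of triangles keeps meeting one of
    them. *)
Definition frequently_right (P : R -> Prop) : Prop :=
  forall Q : R -> Prop, (\forall s \near 0^'+, Q s) -> exists s, Q s /\ P s.

Lemma near_frequently (P : R -> Prop) : (\forall s \near 0^'+, P s) -> frequently_right P.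
Proof.
move=> hP Q hQ; apply: (@filter_ex _ ((0:R)^'+)).
exact: filterI.
Qed.

Lemma frequently_pigeonhole (I : finType) (P : I -> R -> Prop) :
  frequently_right (fun s => exists i, P i s) -> exists i, frequently_right (P i).
Proof.
move=> H; apply: contrapT => /forallNP N.
have /H [s [sQ [i /sQ]]] //: \forall s \near 0^'+, forall i, ~ P i s.
apply: filter_forall => i.
have /existsNP [Q /not_implyP [hQ /forallNP NQ]] := N i.
by apply: filterS hQ => s Qs Ps; apply: (NQ s).
Qed.

Lemma frequently_sub (P P' : R -> Prop) : (forall s, 0 < s -> P s -> P' s) ->
  frequently_right P -> frequently_right P'.
Proof.
move=> PP' H Q hQ.
have : \forall s \near 0^'+, Q s /\ 0 < s.
  by apply: filterI => //; exact: nbhs_right_gt.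
by move=> /H [s [[Qs s0] Ps]]; exists s; split=> //; exact: PP'.
Qed.

Lemma frequently_affine_ge0 (u v : R) : frequently_right (fun s => 0 <= u + s * v) -> 0 <= u.
Proof.
move=> H; rewrite leNgt; apply/negP => u0.
have /H [s [/= + ]] : \forall s \near 0^'+, u + s * v < 0.
  by apply: (@affine_near _ u v [set x | x < 0]); exact: lt_nbhsl.
by rewrite ltNge => /negP.
Qed.

Lemma frequently_area2_ge0 (a b z u : R * R) :
  frequently_right (fun s => 0 <= area2 a b (step z u s)) -> 0 <= area2 a b z.
Proof.
move=> H; apply: (@frequently_affine_ge0 _ (area2 a b (step z u 1) - area2 a b z)).
by apply: frequently_sub H => s _; rewrite area2_step.
Qed.

Lemma frequently_tri (a b c z u : R * R) : 0 < area2 a b c ->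
  frequently_right (fun s => tri a b c (step z u s)) -> tri a b c z.
Proof.
move=> S0 H; apply/triP => //.
by split; apply: (@frequently_area2_ge0 _ _ _ u);
  apply: frequently_sub H => s _ /(triP _ S0) [].
Qed.

Lemma frequently_seg (a b z u : R * R) : a <> b ->
  frequently_right (fun s => seg a b (step z u s)) -> seg a b z.
Proof.
move=> /exists_area2_gt0 [c S0] H; apply: (tri_seg S0).
  by apply: (@frequently_tri _ _ _ _ u S0); apply: frequently_sub H => s _; exact: seg_tri.
apply/eqP; rewrite eq_le -oppr_ge0 -area2_swap.
apply/andP; split; apply: (@frequently_area2_ge0 _ _ _ u); apply: frequently_sub H => s _ h.
  by rewrite (area2_seg (seg_sym h)).
by rewrite (area2_seg h).
Qed.

End Frequently.

(** * Crossing an edge of a triangulation *)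

Section Triangulations.
Variables (R : realType) (tau : R * R) (n : nat) (p : 'I_n -> R * R) (D : set (R * R)).
Implicit Types (a b c d i j k w : 'I_n) (x y z u : R * R) (T : {set {set 'I_n}}).

Local Notation o a b c := (area2 (p a) (p b) (p c)).

Definition inside a b c z : Prop :=
  [/\ 0 < area2 (p a) (p b) z, 0 < area2 (p b) (p c) z & 0 < area2 (p c) (p a) z].

Lemma set3_rot a b c : [set a; b; c]%SET = [set b; c; a]%SET.
Proof. by apply/setP => x; rewrite !inE; do !case: eqP. Qed.

Lemma set3_swap a b c : [set a; b; c]%SET = [set b; a; c]%SET.
Proof. by apply/setP => x; rewrite !inE; do !case: eqP. Qed.

Lemma corner_tri a b c w : w \in [set a; b; c]%SET -> tri (p a) (p b) (p c) (p w).
Proof.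
rewrite !inE => /orP[/orP[]|] /eqP ->.
- exact: tri_corner.
- by do 2 apply: tri_rot; exact: tri_corner.
- by apply: tri_rot; exact: tri_corner.
Qed.

(** [triS] allows any labelling of the set. Whichever is taken, its corners lie in the three
    half-planes that cut out [abc]. *)
Lemma triS_tri a b c z : 0 < o a b c ->
  triS p [set a; b; c]%SET z <-> tri (p a) (p b) (p c) z.
Proof.
move=> S0; split=> [[a' [b' [c' [E H]]]]|]; last by exists a, b, c.
have V w : w \in [set a'; b'; c']%SET -> tri (p a) (p b) (p c) (p w).
  by rewrite -E; exact: corner_tri.
have [va vb vc] : [/\ a' \in [set a'; b'; c']%SET, b' \in [set a'; b'; c']%SET
  & c' \in [set a'; b'; c']%SET] by rewrite !inE !eqxx !orbT.
have /(triP _ S0) [a1 a2 a3] := V _ va; have /(triP _ S0) [b1 b2 b3] := V _ vb.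
have /(triP _ S0) [c1 c2 c3] := V _ vc.
by apply/triP => //; split; apply: (tri_area2_ge0 H).
Qed.

Lemma inside_nbhs a b c z : 0 < o a b c -> inside a b c z ->
  nbhs z (inside a b c).
Proof. by move=> S0 [h1 h2 h3]; exact: tri_nbhs. Qed.

Lemma inside_tri a b c z : 0 < o a b c -> inside a b c z -> tri (p a) (p b) (p c) z.
Proof. by move=> S0 [? ? ?]; apply/triP => //; split; apply: ltW. Qed.

Hypothesis polyP : cyl_polygon tau p D.

Lemma vertex_inj : injective p.
Proof. by case: polyP. Qed.

Lemma succv_ex i : exists j, succv i j.
Proof.
have n0 : (0 < n)%N by case: n i => [[]|].
by exists (Ordinal (ltn_pmod i.+1 n0)).
Qed.

Lemma consec_frontier a b z : consec a b -> seg (p a) (p b) z -> frontier D z.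
Proof.
case: polyP => _ [_ _ _ -> _] [h|h] hz; first by exists a, b.
by exists b, a; split=> //; exact: seg_sym.
Qed.

Lemma vertex_frontier w : frontier D (p w).
Proof.
have [j wj] := succv_ex w; apply: (@consec_frontier w j); first by left.
by exists 0; rewrite lexx ler01 subr0 !mul1r !mul0r !addr0; case: (p w).
Qed.

Lemma nbhs_not_frontier z : nbhs z D -> ~ frontier D z.
Proof. by move=> h [_ /(_ h)]. Qed.

Lemma not_frontier_nbhs z : D z -> ~ frontier D z -> nbhs z D.
Proof.
move=> /(@subset_closure _ D) Dz; rewrite /frontier => h.
by apply: contrapT => h'; apply: h.
Qed.

Section OneTriangulation.
Variable T : {set {set 'I_n}}.
Hypothesis triT : triangulation tau p D T.

Lemma triangulation_rep t : t \in T -> exists a b c, t = [set a; b; c]%SET /\ 0 < o a b c.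
Proof.
case: triT => H _ _ _ _ /H [a [b [c [-> [nc _]]]]].
have : o a b c != 0 by apply/eqP.
rewrite neq_lt => /orP[h|h]; last by exists a, b, c.
by exists b, a, c; rewrite set3_swap area2_swap oppr_gt0.
Qed.

Lemma triangulation_sub a b c z : [set a; b; c]%SET \in T -> 0 < o a b c ->
  tri (p a) (p b) (p c) z -> D z.
Proof. by case: triT => _ H _ _ _ /H {}H S0 h; apply: H; apply/triS_tri. Qed.

Lemma triangulation_cover z : D z ->
  exists a b c, [/\ [set a; b; c]%SET \in T, 0 < o a b c & tri (p a) (p b) (p c) z].
Proof.
case: triT => _ _ H _ _ /H [t [tT tz]].
have [a [b [c [E S0]]]] := triangulation_rep tT.
by exists a, b, c; rewrite E in tT tz; split=> //; apply/triS_tri.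
Qed.

Lemma triangulation_inside a b c a' b' c' z :
  [set a; b; c]%SET \in T -> [set a'; b'; c']%SET \in T ->
  0 < o a b c -> 0 < o a' b' c' ->
  inside a b c z -> inside a' b' c' z -> [set a; b; c]%SET = [set a'; b'; c']%SET.
Proof.
case: triT => _ _ _ H _ tT tT' S0 S0' i1 i2; apply: contrapT => /(H _ _ tT tT') E.
have int d e f : 0 < o d e f -> inside d e f z -> interior (triS p [set d; e; f]%SET) z.
  move=> S /(inside_nbhs S); apply: filterS => y /(inside_tri S) ?.
  exact/triS_tri.
suff : (set0 : set (R * R)) z by [].
by rewrite -E; split; exact: int.
Qed.

(* If some direction u pointed into both triangles at z, their interiors would
   meet near z. *)
Lemma edge_not_frontier_sides a b c a' b' c' z :
  [set a; b; c]%SET \in T -> [set a'; b'; c']%SET \in T ->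
  [set a; b; c]%SET <> [set a'; b'; c']%SET ->
  0 < o a b c -> 0 < o a' b' c' ->
  area2 (p a) (p b) z = 0 -> 0 < area2 (p b) (p c) z -> 0 < area2 (p c) (p a) z ->
  area2 (p a') (p b') z = 0 -> 0 < area2 (p b') (p c') z -> 0 < area2 (p c') (p a') z ->
  (forall u, 0 < area2 (p a) (p b) (step z u 1) -> 0 < area2 (p a') (p b') (step z u 1) ->
    False) /\ nbhs z D.
Proof.
move=> tT tT' ne S0 S0' z1 z2 z3 z1' z2' z3'.
have N u : 0 < area2 (p a) (p b) (step z u 1) -> 0 < area2 (p a') (p b') (step z u 1) -> False.
  move=> h h'.
  have near_pos d e : 0 < area2 (p d) (p e) z ->
      \forall s \near 0^'+, 0 < area2 (p d) (p e) (step z u s).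
    by move=> /near_area2_gt0; exact: step_near.
  have edge_pos d e : area2 (p d) (p e) z = 0 -> 0 < area2 (p d) (p e) (step z u 1) ->
      \forall s \near 0^'+, 0 < area2 (p d) (p e) (step z u s).
    move=> e0 e1; near=> s; rewrite area2_step e0 subr0 add0r mulr_gt0 //.
  have H : \forall s \near (0:R)^'+, inside a b c (step z u s) /\ inside a' b' c' (step z u s).
    by near=> s; split; split; near: s; (exact: near_pos || exact: edge_pos).
  have [s [i1 i2]] := @filter_ex _ ((0:R)^'+) _ _ H.
  exact: ne (triangulation_inside tT tT' S0 S0' i1 i2).
split=> //.
(* A point near [z] on the inner side of either edge is in [D]. If [q] were on the outer side of
   both, the opposite direction [towards q z] would point into both triangles. *)
near=> q.
have [h|h] := lerP 0 (area2 (p a) (p b) q).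
  apply: (triangulation_sub tT S0); apply/triP => //.
  by split=> //; apply: ltW; near: q; exact: near_area2_gt0.
have [h'|h'] := lerP 0 (area2 (p a') (p b') q).
  apply: (triangulation_sub tT' S0'); apply/triP => //.
  by split=> //; apply: ltW; near: q; exact: near_area2_gt0.
have opp d e : area2 (p d) (p e) z = 0 -> area2 (p d) (p e) q < 0 ->
    0 < area2 (p d) (p e) (step z (towards q z) 1).
  move=> e0 e1; have -> : area2 (p d) (p e) (step z (towards q z) 1) =
    2 * area2 (p d) (p e) z - area2 (p d) (p e) q by rewrite /area2 /step /towards /=; ring.
  by rewrite e0 mulr0 sub0r oppr_gt0.
by case: (N (towards q z)); exact: opp.
Unshelve. all: by end_near. Qed.

(** As [z] is interior to [D], both edges are diagonals. They meet at [z], which is not a vertex, so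
    they have the same ends. Equal orientation would put both triangles on the same side. *)
Lemma shared_edge a b c a' b' c' z :
  [set a; b; c]%SET \in T -> [set a'; b'; c']%SET \in T ->
  [set a; b; c]%SET <> [set a'; b'; c']%SET ->
  0 < o a b c -> 0 < o a' b' c' ->
  area2 (p a) (p b) z = 0 -> 0 < area2 (p b) (p c) z -> 0 < area2 (p c) (p a) z ->
  area2 (p a') (p b') z = 0 -> 0 < area2 (p b') (p c') z -> 0 < area2 (p c') (p a') z ->
  (forall w, z <> p w) -> a' = b /\ b' = a.
Proof.
move=> tT tT' ne S0 S0' z1 z2 z3 z1' z2' z3' nv.
have [N nD] := edge_not_frontier_sides tT tT' ne S0 S0' z1 z2 z3 z1' z2' z3'.
have nF := nbhs_not_frontier nD.
have sz := open_segP S0 z1 z2 z3; have sz' := open_segP S0' z1' z2' z3'.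
have nc : ~ consec a b by move=> /consec_frontier /(_ sz).
have nc' : ~ consec a' b' by move=> /consec_frontier /(_ sz').
have ab : a <> b by move=> E; move: S0; rewrite E area2E ltxx.
have ab' : a' <> b' by move=> E; move: S0'; rewrite E area2E ltxx.
have E : [set a; b]%SET = [set a'; b']%SET.
  apply: contrapT => E; case: triT => _ _ _ _ H.
  have [||||w [_ _ /nv]] // := H _ _ a b a' b' tT tT' _ _ _ _ ab ab' nc nc' E _ sz sz';
  by rewrite !inE eqxx ?orbT.
have : a' \in [set a; b]%SET by rewrite E !inE eqxx.
have : b' \in [set a; b]%SET by rewrite E !inE eqxx orbT.
rewrite !inE => /orP[] /eqP eb /orP[] /eqP ea; subst => //.
case: (N (towards z (p c'))).
  by rewrite area2_towards subrr mul0r add0r mul1r.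
by rewrite area2_towards subrr mul0r add0r mul1r.
Qed.

(** Some triangle contains points of the ray arbitrarily close to [z], hence [z] itself because
    triangles are closed. It remains to see that [z] is on one of its edges, and then [shared_edge]
    applies. *)
Lemma cross_edge a b c z u : [set a; b; c]%SET \in T -> 0 < o a b c ->
  area2 (p a) (p b) z = 0 -> 0 < area2 (p b) (p c) z -> 0 < area2 (p c) (p a) z ->
  (forall w, z <> p w) -> area2 (p a) (p b) (step z u 1) < 0 ->
  frequently_right (fun s => D (step z u s)) ->
  exists d, [set b; a; d]%SET \in T /\ 0 < o b a d.
Proof.
move=> tT S0 z1 z2 z3 nv un Du.
have [t Ht] : exists t : {set 'I_n}, frequently_right (fun s => 0 < s /\ t \in T /\ triS p t (step z u s)).
  apply: frequently_pigeonhole; apply: frequently_sub Du => s s0 Ds.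
  have [d [e [f [tT' S0' H]]]] := triangulation_cover Ds.
  by exists [set d; e; f]%SET; split=> //; split=> //; apply/triS_tri.
have [s [s0 [tT' tz]]] : exists s, 0 < s /\ t \in T /\ triS p t (step z u s).
  by have [|s [_ ?]] := Ht (fun=> True); [exact: nearW|exists s].
have [a' [b' [c' [E S0']]]] := triangulation_rep tT'; subst t.
have ne : [set a; b; c]%SET <> [set a'; b'; c']%SET.
  move=> E; move: tz; rewrite -E => /(triS_tri _ S0) /(triP _ S0) [].
  by rewrite area2_step z1 subr0 add0r pmulr_rge0 // leNgt un.
have /(triP _ S0') zt : tri (p a') (p b') (p c') z.
  apply: (@frequently_tri _ _ _ _ _ u S0').
  by apply: frequently_sub Ht => r _ [_ [_ /(triS_tri _ S0')]].
have : exists a' b' c', [/\ [set a'; b'; c']%SET \in T, [set a; b; c]%SET <> [set a'; b'; c']%SET,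
   0 < o a' b' c' & [/\ area2 (p a') (p b') z = 0, 0 < area2 (p b') (p c') z & 0 < area2 (p c') (p a') z]].
  (* Two vanishing areas make [z] a vertex; with exactly one, rotate the labels so that its edge
     comes first. *)
  case: zt; rewrite !le_eqVlt => /orP[/eqP/esym|] h1 /orP[/eqP/esym|] h2 /orP[/eqP/esym|] h3.
  - by case: (nv b'); apply: area2_corner h1 h2.
  - by case: (nv b'); apply: area2_corner h1 h2.
  - by case: (nv a'); apply: (area2_corner _ h3 h1); rewrite -area2_rot.
  - by exists a', b', c'.
  - by case: (nv c'); apply: (area2_corner _ h2 h3); rewrite area2_rot.
  - by exists b', c', a'; rewrite -set3_rot area2_rot.
  - by exists c', a', b'; rewrite set3_rot -area2_rot.
  (* No area vanishes: [z] is inside the new triangle, and moving slightly towards [c] enters [abc]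
     without leaving it. *)
  have H : \forall s \near (0:R)^'+, inside a' b' c' (step z (towards z (p c)) s) /\ 0 < s < 1.
    near=> r; split; last by apply/andP; split=> //; near: r; exact: nbhs_right_lt.
    by near: r; apply: step_near; apply: inside_nbhs.
  have [r [i2 /andP[r0 r1]]] := @filter_ex _ ((0:R)^'+) _ _ H.
  case: ne; apply: (triangulation_inside tT tT' S0 S0' _ i2).
  by split; rewrite area2_towards ?z1 ?area2E ?mulr0 ?addr0 ?add0r mulr_gt0 // subr_gt0.
move=> [d [e [f [tT2 ne2 S2 [w1 w2 w3]]]]].
have [E1 E2] := shared_edge tT tT2 ne2 S0 S2 z1 z2 z3 w1 w2 w3 nv.
by subst d e; exists f.
Unshelve. all: by end_near. Qed.

End OneTriangulation.
End Triangulations.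

(** * Position of the polygon's vertices in the triangles *)

Section Vertices.
Variables (R : realType) (tau : R * R) (n : nat) (p : 'I_n -> R * R) (D : set (R * R)).
Implicit Types (a b c d e i j k w : 'I_n) (x y z u : R * R).
Hypothesis polyP : cyl_polygon tau p D.
Variable T : {set {set 'I_n}}.
Hypothesis triT : triangulation tau p D T.

Local Notation o a b c := (area2 (p a) (p b) (p c)).

Lemma succv_inj i j k : succv i k -> succv j k -> i = j.
Proof.
rewrite /succv => -> E; apply: val_inj => /=.
have := ltn_ord i; have := ltn_ord j; move: E.
case: (ltnP i.+1 n) => hi; case: (ltnP j.+1 n) => hj hE jn iN.
- by move: hE; rewrite !modn_small // => -[].
- have En : j.+1 = n by apply/eqP; rewrite eqn_leq jn hj.
  by move: hE; rewrite En modnn modn_small.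
- have En : i.+1 = n by apply/eqP; rewrite eqn_leq iN hi.
  by move: hE; rewrite En modnn modn_small.
- have En : j.+1 = n by apply/eqP; rewrite eqn_leq jn hj.
  have En' : i.+1 = n by apply/eqP; rewrite eqn_leq iN hi.
  by apply: succn_inj; rewrite En En'.
Qed.

Lemma succv_fun i j k : succv i j -> succv i k -> j = k.
Proof. by rewrite /succv => <- h; apply: val_inj. Qed.

(** The frontier is a finite union of sides, so a single side contains points of the ray arbitrarily
    close to [p w]. Being closed it contains [p w], and since the boundary is simple [w] is one of
    its ends. *)
Lemma boundary_direction w x : x <> p w ->
  (forall s, 0 < s < 1 -> frontier D (step (p w) (towards (p w) x) s)) ->
  exists w' r, [/\ consec w w', 0 < r & p w' = step (p w) (towards (p w) x) r].
Proof.
move=> xw H; have [pI [ncol simple _ fE _]] := polyP.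
have : frequently_right (fun s => exists ij : 'I_n * 'I_n, 0 < s /\ succv ij.1 ij.2 /\
    seg (p ij.1) (p ij.2) (step (p w) (towards (p w) x) s)).
  apply: near_frequently; near=> s.
  have : frontier D (step (p w) (towards (p w) x) s).
    by apply: H; apply/andP; split=> //; near: s; exact: nbhs_right_lt.
  by rewrite fE => -[i [j [ij hz]]]; exists (i, j).
move=> /frequently_pigeonhole [[i j] /= F].
have [|s [_ [s0 [ij hs]]]] := F (fun=> True); first exact: nearW.
have neij : p i <> p j.
  move=> /pI E; have [k jk] := succv_ex j.
  by apply: (ncol i j k) => //; rewrite -E /collinear; ring.
have hw : seg (p i) (p j) (p w).
  by apply: (@frequently_seg _ _ _ _ (towards (p w) x) neij); apply: frequently_sub F => r _ [_ []].
have wij : w = i \/ w = j.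
  have [->|/eqP iw] := eqVneq i w; first by left.
  have [w1 ww1] := succv_ex w.
  have [|a [ha hb /pI E]] := simple i j w w1 ij ww1 iw (p w) hw.
    by exists 0; rewrite lexx ler01 subr0 !mul1r !mul0r !addr0; case: (p w).
  by subst a; case: ha; [left|right].
have [w' [ww' hs']] : exists w', consec w w' /\ seg (p w) (p w') (step (p w) (towards (p w) x) s).
  case: wij => E; subst w; first by exists j; split=> //; left.
  by exists i; split; [right|apply: seg_sym].
have [r [/andP[r0 r1] E]] := (segP _ _ _).1 hs'.
have rn0 : r != 0.
  apply: contra_notN xw => /eqP r00; move: E; rewrite r00 /step /towards /= !mul0r !addr0.
  clear H F hs hs' hw; case: x (p w) => [x1 x2] [y1 y2] /= [] e1 e2.
  have : s * (x1 - y1) == 0 by apply/eqP; lra.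
  have : s * (x2 - y2) == 0 by apply/eqP; lra.
  by rewrite !mulf_eq0 gt_eqF //= !subr_eq0 => /eqP -> /eqP ->.
have rp : 0 < r by rewrite lt0r rn0.
exists w', (s / r); split=> //; first exact: divr_gt0.
move: E; rewrite /step /towards /=; case: x (p w) (p w') {xw H F hs hw hs' neij} => [x1 x2] [y1 y2] [v1 v2] /= [] e1 e2.
have f1 : s * (x1 - y1) = r * (v1 - y1) by lra.
have f2 : s * (x2 - y2) = r * (v2 - y2) by lra.
by congr pair; rewrite mulrAC ?f1 ?f2; field.
Unshelve. all: by end_near. Qed.

(* Next to p w on the edge there is a point off the frontier, since the two
   boundary edges at p w are not collinear. Crossing there yields a second
   triangle on ab, which puts p w in the interior of D. *)
Lemma edge_no_vertex a b c w : [set a; b; c]%SET \in T -> 0 < o a b c ->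
  o a b w = 0 -> 0 < o b c w -> 0 < o c a w -> False.
Proof.
move=> tT S0 w1 w2 w3; have [pI [ncol _ _ _ _]] := polyP.
have free e : 0 <= o b c e -> 0 <= o c a e -> o a b e = 0 -> forall s, 0 < s < 1 ->
    frontier D (step (p w) (towards (p w) (p e)) s).
  move=> e2 e3 e1 s /andP[s0 s1]; apply: contrapT.
  set z := step _ _ _ => nF.
  have z1 : area2 (p a) (p b) z = 0 by rewrite area2_towards w1 e1 !mulr0 addr0.
  have wlt (r q u v : R) : 0 < r -> 0 < q -> 0 < u -> 0 <= v -> 0 < r * u + q * v.
    by move=> ? ? ? ?; apply: ltr_pwDl; [exact: mulr_gt0|apply: mulr_ge0 => //; exact: ltW].
  have z2 : 0 < area2 (p b) (p c) z.
    by rewrite area2_towards; apply: wlt => //; rewrite subr_gt0.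
  have z3 : 0 < area2 (p c) (p a) z.
    by rewrite area2_towards; apply: wlt => //; rewrite subr_gt0.
  have Dz : D z.
    by apply: (triangulation_sub triT tT S0); apply: seg_tri; exact: open_segP S0 z1 z2 z3.
  have nD := not_frontier_nbhs Dz nF.
  have nv k : z <> p k by move=> E; apply: nF; rewrite E; exact: vertex_frontier polyP k.
  have un : area2 (p a) (p b) (step z (towards (p c) z) 1) < 0.
    rewrite (_ : area2 _ _ _ = 2 * area2 (p a) (p b) z - o a b c); last first.
      by rewrite /area2 /step /towards /=; ring.
    by rewrite z1 mulr0 sub0r oppr_lt0.
  have [d [tT' S0']] := cross_edge polyP triT tT S0 z1 z2 z3 nv un
     (near_frequently (step_near _ nD)).
  apply: (nbhs_not_frontier _ (vertex_frontier polyP w)).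
  have [h1 h2] := area2_across (p c) (p d) w1.
  have w1' : o b a w = 0 by rewrite area2_swap w1 oppr0.
  have w2' : 0 < o a d w by rewrite -(pmulr_rgt0 _ S0) h1 mulr_gt0.
  have w3' : 0 < o d b w by rewrite -(pmulr_rgt0 _ S0) h2 mulr_gt0.
  have ne : [set a; b; c]%SET <> [set b; a; d]%SET.
    move=> E; have : d \in [set a; b; c]%SET by rewrite E !inE eqxx orbT.
    rewrite !inE => /orP[/orP[]|] /eqP Ed; move: S0'; rewrite Ed ?area2E ?ltxx //.
    by rewrite area2_swap oppr_gt0 ltNge ltW.
  by have [_] := edge_not_frontier_sides triT tT tT' ne S0 S0' w1 w2 w3 w1' w2' w3'.
(* Otherwise the frontier runs along the edge on both sides of [p w], so the two neighbours of [w]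
   lie in the opposite directions of [p a] and [p b]. *)
have [w' [r [cw r0 Ew]]] := @boundary_direction w (p a) ltac:(move=> E; move: w3; rewrite -E area2E ltxx //)
  (free a ltac:(by rewrite area2_rot ltW) ltac:(by rewrite area2E) ltac:(by rewrite area2E)).
have [v' [q [cv q0 Ev]]] := @boundary_direction w (p b) ltac:(move=> E; move: w2; rewrite -E area2E ltxx //)
  (free b ltac:(by rewrite area2E) ltac:(by rewrite -area2_rot ltW) ltac:(by rewrite area2E)).
have neq : w' <> v'.
  move=> E; have : o c w w' = o c w v' by rewrite E.
  rewrite Ew Ev !area2_towards !area2E !mulr0 !add0r.
  have -> : o c w a = - o c a w by rewrite /area2; ring.
  have -> : o c w b = o b c w by rewrite /area2; ring.
  by have := mulr_gt0 r0 w3; have := mulr_gt0 q0 w2; lra.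
have col : o w' w v' = 0.
  rewrite Ew Ev (_ : area2 _ _ _ = - r * q * o a b w); first by rewrite w1 mulr0.
  by rewrite /area2 /step /towards /=; ring.
case: cw cv => [cw|cw] [cv|cv].
- by apply: neq; exact: succv_fun cw cv.
- apply: (ncol _ _ _ cv cw); apply: (etrans (y := - o w' w v')); last by rewrite col oppr0.
  by rewrite /area2; ring.
- exact: (ncol _ _ _ cw cv).
- by apply: neq; exact: succv_inj cw cv.
Qed.

(** A point inside a triangle is interior to [D], while vertices are on the frontier;
    [edge_no_vertex] excludes the open edges. *)
Lemma vertex_corner a b c w : [set a; b; c]%SET \in T -> 0 < o a b c ->
  tri (p a) (p b) (p c) (p w) -> w \in [set a; b; c]%SET.
Proof.
move=> tT S0 /(triP _ S0) []; have pI := vertex_inj polyP.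
rewrite !le_eqVlt => /orP[/eqP/esym|] h1 /orP[/eqP/esym|] h2 /orP[/eqP/esym|] h3.
- by have /pI -> := area2_corner S0 h1 h2; rewrite !inE eqxx ?orbT.
- by have /pI -> := area2_corner S0 h1 h2; rewrite !inE eqxx ?orbT.
- have /pI -> : p w = p a by apply: (area2_corner _ h3 h1); rewrite -area2_rot.
  by rewrite !inE eqxx ?orbT.
- by case: (edge_no_vertex tT S0 h1 h2 h3).
- have /pI -> : p w = p c by apply: (area2_corner _ h2 h3); rewrite area2_rot.
  by rewrite !inE eqxx ?orbT.
- by case: (@edge_no_vertex b c a w) => //; [rewrite -set3_rot|rewrite area2_rot].
- by case: (@edge_no_vertex c a b w) => //; [rewrite set3_rot|rewrite -area2_rot].
- case: (nbhs_not_frontier _ (vertex_frontier polyP w)).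
  have := inside_nbhs S0 (And3 h1 h2 h3); apply: filterS => y /(inside_tri S0) h.
  exact: (triangulation_sub triT tT S0 h).
Qed.

End Vertices.

(** * Locally convex triangulations *)

Section Walk.
Variables (R : realType) (tau : R * R) (n : nat) (p : 'I_n -> R * R) (D : set (R * R)).
Implicit Types (a b c d e i j k w : 'I_n) (x y z u : R * R) (T : {set {set 'I_n}}).
Hypothesis polyP : cyl_polygon tau p D.
Variable W : 'I_n -> R.

Local Notation o a b c := (area2 (p a) (p b) (p c)).
Local Notation exc := (excess p W).

Definition locally_convex T : Prop := forall a b c d,
  [set a; b; c]%SET \in T -> [set b; a; d]%SET \in T -> 0 < o a b c -> 0 < o b a d ->
  0 <= exc a b c d.

Lemma excess_rot a b c d : exc b c a d = exc a b c d.
Proof. by rewrite /excess /area2; ring. Qed.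

Lemma excess_corner a b c d : d \in [set a; b; c]%SET -> exc a b c d = 0.
Proof. by rewrite !inE => /orP[/orP[]|] /eqP ->; rewrite /excess /area2; ring. Qed.

(** The interpolations over [abc] and [bad] agree on the line [ab], so their difference is a
    multiple of the distance to that line; its value at [d] fixes the factor. *)
Lemma excess_across a b c d v :
  o b a d * exc a b c v = o a b c * exc b a d v + o b a v * exc a b c d.
Proof. by rewrite /excess /area2; ring. Qed.

Lemma seg_suffix x y s : 0 <= s <= 1 ->
  seg (step x (towards x y) s) y `<=` seg x y.
Proof.
move=> /andP[s0 s1] z [r [/andP[r0 r1] ->]]; exists (s + r * (1 - s)); split.
  by apply/andP; split; nra.
by rewrite /step /towards /=; congr pair; ring.
Qed.

(** [X] and [V] are the values of an affine function at the ends of the unit interval; [s] is its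
    zero [X / (X - V)] if [V < 0], and 1 otherwise. *)
Lemma affine_exit (X V : R) : 0 < X -> exists s, [/\ 0 < s <= 1,
  (forall r, 0 <= r <= s -> 0 <= (1 - r) * X + r * V) &
  s < 1 -> V < 0 /\ (1 - s) * X + s * V = 0].
Proof.
move=> X0; have [V0|V0] := ltP V 0; last first.
  exists 1; split; rewrite ?ltxx ?ltr01 ?lexx // => r /andP[r0 r1].
  by rewrite addr_ge0 ?mulr_ge0 ?subr_ge0 // ltW.
have XV : 0 < X - V by lra.
have XVn : X - V != 0 by rewrite gt_eqF.
have E : X / (X - V) * (X - V) = X by rewrite divfK.
exists (X / (X - V)); split.
- by rewrite divr_gt0 // ler_pdivrMr //; lra.
- by move=> r /andP[r0]; rewrite ler_pdivlMr // => h; lra.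
- by move=> _; split=> //; lra.
Qed.

(** The least of the three exit times tells which side is crossed first; [ok] describes the times up
    to that minimum. *)
Lemma triangle_exit (X1 X2 X3 V1 V2 V3 : R) : 0 < X1 -> 0 < X2 -> 0 < X3 ->
  ~ [/\ 0 <= V1, 0 <= V2 & 0 <= V3] ->
  let f X V s := (1 - s) * X + s * V in
  exists s, 0 < s < 1 /\
  [\/ [/\ V1 < 0, f X1 V1 s = 0, 0 <= f X2 V2 s & 0 <= f X3 V3 s],
      [/\ V2 < 0, f X2 V2 s = 0, 0 <= f X3 V3 s & 0 <= f X1 V1 s] |
      [/\ V3 < 0, f X3 V3 s = 0, 0 <= f X1 V1 s & 0 <= f X2 V2 s]].
Proof.
move=> X10 X20 X30 nV f.
have [s1 [/andP[a1 b1] c1 d1]] := affine_exit V1 X10.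
have [s2 [/andP[a2 b2] c2 d2]] := affine_exit V2 X20.
have [s3 [/andP[a3 b3] c3 d3]] := affine_exit V3 X30.
pose ok s := [/\ 0 < s, s <= s1, s <= s2 & s <= s3].
have nok : ok 1 -> False.
  move=> [_ e1 e2 e3]; apply: nV.
  have := c1 1 ltac:(by rewrite ler01); have := c2 1 ltac:(by rewrite ler01).
  by have := c3 1 ltac:(by rewrite ler01); rewrite subrr !mul0r !add0r !mul1r; split.
have ge s : ok s -> [/\ 0 <= f X1 V1 s, 0 <= f X2 V2 s & 0 <= f X3 V3 s].
  by move=> [e0 e1 e2 e3]; split; [apply: c1|apply: c2|apply: c3]; rewrite (ltW e0).
have lt1 s : ok s -> s < 1.
  move=> h; rewrite ltNge; apply/negP => h1; apply: nok; case: h => e0 e1 e2 e3.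
  by split=> //; lra.
have [h12|h12] := leP s1 s2; have [h13|h13] := leP s1 s3; have [h23|h23] := leP s2 s3.
- have k : ok s1 by split. 
  exists s1; rewrite a1 (lt1 _ k); split=> //; constructor 1.
  by have [? ? ?] := ge _ k; have [? ?] := d1 (lt1 _ k).
- have k : ok s1 by split.
  exists s1; rewrite a1 (lt1 _ k); split=> //; constructor 1.
  by have [? ? ?] := ge _ k; have [? ?] := d1 (lt1 _ k).
- by exfalso; lra.
- have k : ok s3 by split=> //; lra.
  exists s3; rewrite a3 (lt1 _ k); split=> //; constructor 3.
  by have [? ? ?] := ge _ k; have [? ?] := d3 (lt1 _ k).
- have k : ok s2 by split=> //; lra.
  exists s2; rewrite a2 (lt1 _ k); split=> //; constructor 2.
  by have [? ? ?] := ge _ k; have [? ?] := d2 (lt1 _ k).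
- by exfalso; lra.
- have k : ok s2 by split=> //; lra.
  exists s2; rewrite a2 (lt1 _ k); split=> //; constructor 2.
  by have [? ? ?] := ge _ k; have [? ?] := d2 (lt1 _ k).
- have k : ok s3 by split=> //; lra.
  exists s3; rewrite a3 (lt1 _ k); split=> //; constructor 3.
  by have [? ? ?] := ge _ k; have [? ?] := d3 (lt1 _ k).
Qed.

(** The labels are rotated so that the exit edge comes first. Since [x] is on no line joining [p v]
    to another vertex, the exit point is not a vertex. *)
Lemma inside_exit a b c x v : 0 < o a b c -> inside p a b c x ->
  ~ tri (p a) (p b) (p c) (p v) -> (forall w, w != v -> area2 (p w) (p v) x != 0) ->
  exists a' b' c' s, let z := step x (towards x (p v)) s in
  [/\ [set a'; b'; c']%SET = [set a; b; c]%SET, exc a' b' c' v = exc a b c v,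
      0 < o a' b' c', 0 < s < 1 &
      [/\ o a' b' v < 0, area2 (p a') (p b') z = 0, 0 < area2 (p b') (p c') z,
        0 < area2 (p c') (p a') z & forall w, z <> p w]].
Proof.
move=> S0 [x1 x2 x3] nT off.
have nV : ~ [/\ 0 <= o a b v, 0 <= o b c v & 0 <= o c a v] by move=> H; apply: nT; apply/triP.
have [s [/andP[s0 s1] H]] := triangle_exit x1 x2 x3 nV.
set z := step x (towards x (p v)) s.
have fin a' b' c' : 0 < o a' b' c' -> o a' b' v < 0 -> area2 (p a') (p b') z = 0 ->
    0 <= area2 (p b') (p c') z -> 0 <= area2 (p c') (p a') z ->
    [/\ o a' b' v < 0, area2 (p a') (p b') z = 0, 0 < area2 (p b') (p c') z,
        0 < area2 (p c') (p a') z & forall w, z <> p w].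
  move=> S0' v0 z1 z2 z3.
  have nv w : z <> p w.
    move=> E; have [Ew|wv] := eqVneq w v.
      by move: z1 v0; rewrite E Ew => ->; rewrite ltxx.
    have := off w wv; have : area2 (p w) (p v) z = (1 - s) * area2 (p w) (p v) x.
      by rewrite area2_towards area2E mulr0 addr0.
    rewrite E area2E => /esym /eqP; rewrite mulf_eq0 subr_eq0 => /orP[/eqP E1|->//].
    by move: s1; rewrite -E1 ltxx.
  split=> //; rewrite lt_neqAle ?z2 ?z3 andbT; apply/eqP => /esym h.
    by apply: (nv b'); apply: area2_corner z1 h.
  by apply: (nv a'); apply: (area2_corner _ h z1); rewrite -area2_rot.
rewrite -!area2_towards -/z in H.
case: H => -[v0 z1 z2 z3].
- by exists a, b, c, s; split; rewrite ?s0 //; exact: fin.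
- exists b, c, a, s; split; rewrite ?s0 //; last by apply: fin => //; rewrite area2_rot.
  + by rewrite -set3_rot.
  + exact: excess_rot.
  + by rewrite area2_rot.
- exists c, a, b, s; split; rewrite ?s0 //; last by apply: fin => //; rewrite -area2_rot.
  + by rewrite set3_rot.
  + by rewrite -excess_rot.
  + by rewrite -area2_rot.
Qed.

Variable T : {set {set 'I_n}}.
Hypotheses (triT : triangulation tau p D T) (convT : locally_convex T).

(* Crossing an edge towards v only raises the value at v of the interpolation
   over the current triangle, and it equals W v at the end. *)
Lemma walk a b c x v :
  [set a; b; c]%SET \in T -> 0 < o a b c -> inside p a b c x ->
  seg x (p v) `<=` D -> (forall w, w != v -> area2 (p w) (p v) x != 0) ->
  0 <= exc a b c v.
Proof.
(* Induction on the number of triangles met by the rest of the segment: a triangle that has been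
   left is never met again. *)
pose hit x := [set t in T | `[< exists q, seg x (p v) q /\ triS p t q >]]%SET.
have [m] := ubnP #|hit x|.
elim: m x a b c => // m IH x a b c Hm tT S0 ix xD off.
have [tv|ntv] := pselect (tri (p a) (p b) (p c) (p v)).
  by rewrite excess_corner // (vertex_corner polyP triT).
have [a' [b' [c' [s [E Ee S0' s01 [v0 z1 z2 z3 nv]]]]]] := inside_exit S0 ix ntv off.
set z := step x (towards x (p v)) s in z1 z2 z3 nv.
have [s0 s1] := andP s01; have s01' : 0 <= s <= 1 by rewrite !ltW.
rewrite -Ee; rewrite -E in tT.
have zD : seg z (p v) `<=` D.
  by move=> q hq; apply: xD; exact: (seg_suffix s01' hq).
have un : area2 (p a') (p b') (step z (towards z (p v)) 1) < 0.
  by rewrite area2_towards subrr mul0r add0r mul1r.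
have fD : frequently_right (fun r => D (step z (towards z (p v)) r)).
  apply: near_frequently; near=> r; apply: zD; apply/segP; exists r; split=> //.
  by apply/andP; split=> //; near: r; exact: nbhs_right_ltW.
have [d [tT' Sd]] := cross_edge polyP triT tT S0' z1 z2 z3 nv un fD.
have [h1 h2] := area2_across (p c') (p d) z1.
have z2' : 0 < area2 (p a') (p d) z by rewrite -(pmulr_rgt0 _ S0') h1 mulr_gt0.
have z3' : 0 < area2 (p d) (p b') z by rewrite -(pmulr_rgt0 _ S0') h2 mulr_gt0.
(* The induction needs a start inside the new triangle, so go slightly beyond [z]. *)
have H : \forall r \near (0:R)^'+, inside p b' a' d (step z (towards z (p v)) r) /\ 0 < r < 1.
  near=> r; have r1 : 0 < r < 1 by apply/andP; split=> //; near: r; exact: nbhs_right_lt.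
  split=> //; split; last 2 first.
  - by near: r; exact: (step_near _ (near_area2_gt0 z2')).
  - by near: r; exact: (step_near _ (near_area2_gt0 z3')).
  case/andP: r1 => r0 r1; rewrite area2_towards area2_swap z1 oppr0 mulr0 add0r.
  by rewrite mulr_gt0 // area2_swap oppr_gt0.
have [r [iy /andP[r0 r1]]] := @filter_ex _ ((0:R)^'+) _ _ H.
set y := step z (towards z (p v)) r in iy.
have yz : seg y (p v) `<=` seg z (p v) by apply: seg_suffix; rewrite !ltW.
have : 0 <= exc b' a' d v.
  apply: (IH y) => //; last first.
  - move=> w wv; rewrite /y /z !area2_towards !area2E !mulr0 !addr0.
    by rewrite !mulf_neq0 ?off // subr_eq0 gt_eqF.
  - by move=> q /yz /zD.
  apply: (@leq_trans #|hit x|); last by rewrite -ltnS.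
  apply: proper_card; apply/properP; split.
    apply/fintype.subsetP => t; rewrite !inE => /andP[-> /asboolP[q [hq tq]]]; apply/asboolP.
    by exists q; split=> //; exact: (seg_suffix s01' (yz _ hq)).
  exists [set a'; b'; c']%SET; rewrite !inE tT /=.
    apply/asboolP; exists x; split.
      by exists 0; rewrite lexx ler01 subr0 !mul1r !mul0r !addr0; case: (x).
    by rewrite E; apply/triS_tri => //; exact: inside_tri.
  apply/asboolP => -[q [/segP [l [/andP[l0 l1] ->]] /(triS_tri _ S0') /(triP _ S0') []]].
  rewrite area2_towards /y area2_towards z1 mulr0 add0r => + _ _; apply/negP; rewrite -ltNge.
  have -> : (1 - l) * (r * o a' b' v) + l * o a' b' v = ((1 - l) * r + l) * o a' b' v by ring.
  rewrite nmulr_llt0 //; nra.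
move=> ge; rewrite -(pmulr_rge0 _ Sd) excess_across; apply: addr_ge0; apply: mulr_ge0 => //.
- exact: ltW.
- by rewrite area2_swap oppr_ge0 ltW.
- exact: convT.
Unshelve. all: by end_near. Qed.

End Walk.

(** * Uniqueness of the locally convex triangulation *)

Section Uniqueness.
Variables (R : realType) (tau : R * R) (n : nat) (p : 'I_n -> R * R) (D : set (R * R)).
Implicit Types (a b c d e i j k w : 'I_n) (x y z u : R * R) (T : {set {set 'I_n}}).
Hypothesis polyP : cyl_polygon tau p D.
Variable W : 'I_n -> R.
Local Notation o a b c := (area2 (p a) (p b) (p c)).
Local Notation exc := (excess p W).

Hypothesis generic : forall a b c d, o a b c != 0 -> d != a -> d != b -> d != c ->
  exc a b c d != 0.

(* Both sides measure, at x, the difference of the interpolations of W over the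
   two triangles. *)
Lemma excess_exchange a b c a' b' c' x :
  area2 (p b') (p c') x * exc a b c a' + area2 (p c') (p a') x * exc a b c b'
    + area2 (p a') (p b') x * exc a b c c' =
  - (area2 (p b) (p c) x * exc a' b' c' a + area2 (p c) (p a) x * exc a' b' c' b
    + area2 (p a) (p b) x * exc a' b' c' c).
Proof. by rewrite /excess /area2; ring. Qed.

Lemma area2_neq a b c : 0 < o a b c -> [/\ a != b, b != c & c != a].
Proof. by move=> S0; split; apply: contraTneq S0 => ->; rewrite area2E ltxx. Qed.

Lemma off_lines_inside a b c x : 0 < o a b c -> off_lines p x ->
  tri (p a) (p b) (p c) x -> inside p a b c x.
Proof.
move=> S0 off /(triP _ S0) [h1 h2 h3]; have [ab bc ca] := area2_neq S0.
by split; rewrite lt_neqAle eq_sym off.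
Qed.

Lemma exists_inside a b c : 0 < o a b c -> exists x, inside p a b c x.
Proof.
move=> S0; pose x := (((p a).1 + (p b).1 + (p c).1) / 3, ((p a).2 + (p b).2 + (p c).2) / 3).
exists x; split.
- by rewrite (_ : area2 _ _ x = o a b c / 3) ?divr_gt0 // /x /area2 /=; field.
- by rewrite (_ : area2 _ _ x = o a b c / 3) ?divr_gt0 // /x /area2 /=; field.
- by rewrite (_ : area2 _ _ x = o a b c / 3) ?divr_gt0 // /x /area2 /=; field.
Qed.

Lemma seg_sub_tri (a b c x v : R * R) : 0 < area2 a b c -> tri a b c x -> tri a b c v ->
  seg x v `<=` tri a b c.
Proof.
move=> S0 /(triP _ S0) [x1 x2 x3] /(triP _ S0) [v1 v2 v3] q /segP [s [/andP[s0 s1] ->]].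
by apply/triP => //; split; rewrite area2_towards addr_ge0 // mulr_ge0 // subr_ge0.
Qed.

(** [D] need not be convex, but from [x] the corners of the triangle of [T'] around [x] are visible
    within that triangle, so the walk through [T] can be directed to them. *)
Lemma walk_to_corner T T' a b c a' b' c' x v :
  triangulation tau p D T -> locally_convex p W T -> triangulation tau p D T' ->
  [set a; b; c]%SET \in T -> [set a'; b'; c']%SET \in T' ->
  0 < o a b c -> 0 < o a' b' c' -> off_lines p x -> inside p a b c x -> inside p a' b' c' x ->
  v \in [set a'; b'; c']%SET -> 0 <= exc a b c v.
Proof.
move=> triT convT triT' tT tT' S0 S0' off ix ix' hv.
apply: (walk polyP triT convT tT S0 ix) => [q hq|w wv]; last exact: off.
apply: (triangulation_sub triT' tT' S0'); apply: seg_sub_tri hq => //.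
  exact: inside_tri.
exact: corner_tri.
Qed.

(** At a common generic point each interpolation is at most the other, so they agree there and every
    excess involved is zero. By genericity, a zero excess occurs only at a corner. *)
Lemma locally_convex_sub T T' : triangulation tau p D T -> triangulation tau p D T' ->
  locally_convex p W T -> locally_convex p W T' -> T \subset T'.
Proof.
move=> triT triT' convT convT'; apply/fintype.subsetP => t tT.
have [a [b [c [E S0]]]] := triangulation_rep triT tT; subst t.
have [x0 ix0] := exists_inside S0.
have [x ix off] := exists_off_lines (vertex_inj polyP) (inside_nbhs S0 ix0).
have [a' [b' [c' [tT' S0' xt']]]] := triangulation_cover triT' (triangulation_sub triT tT S0 (inside_tri S0 ix)).
have ix' := off_lines_inside S0' off xt'.
have H v := walk_to_corner triT convT triT' tT tT' S0 S0' off ix ix' (v := v).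
have H' v := walk_to_corner triT' convT' triT tT' tT S0' S0 off ix' ix (v := v).
have [q1 q2 q3] := ix'; have [r1 r2 r3] := ix.
have He := excess_exchange a b c a' b' c' x.
have a0 := H a' ltac:(by rewrite !inE eqxx); have b0 := H b' ltac:(by rewrite !inE eqxx ?orbT).
have c0 := H c' ltac:(by rewrite !inE eqxx ?orbT).
have a0' := H' a ltac:(by rewrite !inE eqxx); have b0' := H' b ltac:(by rewrite !inE eqxx ?orbT).
have c0' := H' c ltac:(by rewrite !inE eqxx ?orbT).
have sum0 : area2 (p b) (p c) x * exc a' b' c' a + area2 (p c) (p a) x * exc a' b' c' b
    + area2 (p a) (p b) x * exc a' b' c' c = 0.
  apply/eqP; rewrite eq_le; apply/andP; split.
    by rewrite -oppr_ge0 -He !addr_ge0 // mulr_ge0 // ltW.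
  by rewrite !addr_ge0 // mulr_ge0 // ltW.
have zero v : v \in [set a; b; c]%SET -> exc a' b' c' v = 0.
  have ma := mulr_ge0 (ltW r2) a0'; have mb := mulr_ge0 (ltW r3) b0'.
  have mc := mulr_ge0 (ltW r1) c0'.
  move: sum0 => /eqP; rewrite paddr_eq0 ?addr_ge0 // paddr_eq0 //.
  rewrite !mulf_eq0 (gt_eqF r1) (gt_eqF r2) (gt_eqF r3) /= => /andP[/andP[/eqP ea /eqP eb] /eqP ec].
  by rewrite !inE => /orP[/orP[]|] /eqP ->.
have sub : [set a; b; c]%SET \subset [set a'; b'; c']%SET.
  apply/fintype.subsetP => v /zero /eqP; rewrite !inE; apply: contraTT; rewrite !negb_or -andbA => /and3P[? ? ?].
  by apply: generic => //; rewrite gt_eqF.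
suff -> : [set a; b; c]%SET = [set a'; b'; c']%SET by [].
apply/eqP; rewrite eqEcard sub /=.
have [ab bc ca] := area2_neq S0; have [ab' bc' ca'] := area2_neq S0'.
have card3 d e f : d != e -> e != f -> f != d -> #|[set d; e; f]%SET| = 3%N.
  by move=> de ef fd; rewrite finset.setUC cardsU1 cards2 !inE negb_or fd (eq_sym f) ef de.
by rewrite !card3.
Qed.

End Uniqueness.

(** * The two diagonals of a convex quadrilateral *)

Section Quadrilateral.
Variable R : realType.
Implicit Types (a b c d z : R * R).

Lemma quad_tri a b c d z : 0 < area2 a b c -> 0 < area2 b a d ->
  0 <= area2 b c z -> 0 <= area2 c a z -> 0 <= area2 a d z -> 0 <= area2 d b z ->
  tri a b c z \/ tri b a d z.
Proof.
move=> S0 S0' z1 z2 z3 z4; have [h|h] := lerP 0 (area2 a b z); first by left; apply/triP.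
by right; apply/triP => //; rewrite area2_swap oppr_ge0 (ltW h).
Qed.

(** The triangles on [cd] lie in the four half-planes of the sides, and [ab] cuts the intersection
    of these into the other two triangles. *)
Lemma quad_cover a b c d z : 0 < area2 a b c -> 0 < area2 b a d ->
  0 < area2 b c d -> 0 < area2 c a d -> tri c a d z \/ tri b c d z ->
  tri a b c z \/ tri b a d z.
Proof.
move=> S1 S2 S3 S4 H.
have f (x y u : R * R) : 0 < area2 x y u -> 0 <= area2 y u x /\ 0 <= area2 u x y.
  by move=> /ltW h; split; [rewrite area2_rot|rewrite -area2_rot].
have [? ?] := f _ _ _ S1; have [? ?] := f _ _ _ S2.
have [? ?] := f _ _ _ S3; have [? ?] := f _ _ _ S4.
apply: quad_tri => //; case: H => /tri_area2_ge0; apply; rewrite ?area2E ?lexx //; try exact: ltW.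
Qed.

End Quadrilateral.

(** * Flipping an edge *)

Section Flip.
Variables (R : realType) (tau : R * R) (n : nat) (p : 'I_n -> R * R) (D : set (R * R)).
Implicit Types (a b c d e f g i j k w : 'I_n) (z u : R * R) (T : {set {set 'I_n}}).
Hypotheses (tau0 : tau <> (0, 0)) (polyP : cyl_polygon tau p D).
Local Notation o a b c := (area2 (p a) (p b) (p c)).

Lemma cyl_segment_lift_sym (x y : R * R) : cyl_segment_lift tau x y -> cyl_segment_lift tau y x.
Proof. by move=> /(cyl_segment_liftP _ _ tau0) /short_sym /(cyl_segment_liftP _ _ tau0). Qed.

Lemma admissible_diag_sym a b : admissible_diag tau p D a b -> admissible_diag tau p D b a.
Proof.
move=> [ab nc h s]; split; first by move/esym.
- by move=> [h'|h']; apply: nc; [right|left].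
- exact: cyl_segment_lift_sym.
- by move=> z /seg_sym; exact: s.
Qed.

Lemma area2_distinct a b c x y w : 0 < o a b c ->
  x \in [set a; b; c]%SET -> y \in [set a; b; c]%SET -> w \in [set a; b; c]%SET ->
  x != y -> y != w -> w != x -> o x y w != 0.
Proof.
rewrite !inE => S0 /orP[/orP[]|] /eqP -> /orP[/orP[]|] /eqP -> /orP[/orP[]|] /eqP ->;
rewrite ?eqxx // => _ _ _; move: S0; rewrite /area2 => S0; apply/eqP => E; lra.
Qed.

Section OneTriangulation.
Variable T : {set {set 'I_n}}.
Hypothesis triT : triangulation tau p D T.

Lemma triangulation_short t x y : t \in T -> x \in t -> y \in t -> x != y ->
  cyl_segment_lift tau (p x) (p y).
Proof.
case: triT => H _ _ _ _ /H [a [b [c [-> [_ [h1 h2 h3 _]]]]]].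
have h1' := cyl_segment_lift_sym h1; have h2' := cyl_segment_lift_sym h2.
have h3' := cyl_segment_lift_sym h3.
rewrite !inE => /orP[/orP[]|] /eqP -> /orP[/orP[]|] /eqP -> //; by rewrite eqxx.
Qed.

Lemma triangulation_diag t x y : t \in T -> x \in t -> y \in t -> x <> y ->
  consec x y \/ admissible_diag tau p D x y.
Proof. by case: triT => H _ _ _ _ /H [a [b [c [_ [_ [_ _ _ h]]]]]]; exact: h. Qed.

Lemma edge_vertex t x y w : t \in T -> x \in t -> y \in t -> x != y ->
  seg (p x) (p y) (p w) -> w \in [set x; y]%SET.
Proof.
move=> tT; have [a [b [c [E S0]]]] := triangulation_rep triT tT; subst t => hx hy xy hw.
have wt : w \in [set a; b; c]%SET.
  apply: (vertex_corner polyP triT tT S0); apply: seg_sub_tri hw => //; exact: corner_tri.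
rewrite !inE; apply: contraT; rewrite negb_or => /andP[wx wy].
have := area2_distinct S0 hx hy wt xy; rewrite eq_sym wy wx => /(_ isT isT).
by rewrite (area2_seg hw) eqxx.
Qed.

Lemma triangulation_off t t' z : t \in T -> t' \in T -> off_lines p z ->
  triS p t z -> triS p t' z -> t = t'.
Proof.
move=> tT tT' off.
have [a [b [c [E S0]]]] := triangulation_rep triT tT.
have [a' [b' [c' [E' S0']]]] := triangulation_rep triT tT'; subst t t'.
move=> /(triS_tri _ S0) h /(triS_tri _ S0') h'.
exact: (triangulation_inside triT tT tT' S0 S0' (off_lines_inside S0 off h)
  (off_lines_inside S0' off h')).
Qed.

Variables (a b c d : 'I_n).
Hypotheses (tT : [set a; b; c]%SET \in T) (tT' : [set b; a; d]%SET \in T).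
Hypotheses (S1 : 0 < o a b c) (S2 : 0 < o b a d) (S3 : 0 < o b c d) (S4 : 0 < o c a d).

Let pos1 : [/\ 0 < o b c a & 0 < o c a b].
Proof. by split; [rewrite area2_rot|rewrite -area2_rot]. Qed.
Let pos2 : [/\ 0 < o a d b & 0 < o d b a].
Proof. by split; [rewrite area2_rot|rewrite -area2_rot]. Qed.
Let pos3 : [/\ 0 < o c d b & 0 < o d b c].
Proof. by split; [rewrite area2_rot|rewrite -area2_rot]. Qed.
Let pos4 : [/\ 0 < o a d c & 0 < o d c a].
Proof. by split; [rewrite area2_rot|rewrite -area2_rot]. Qed.

Let neqs : [/\ a != b, b != c & c != a] /\ [/\ b != d, c != d & a != d].
Proof.
have [? ? ?] := area2_neq S1; have [? ? _] := area2_neq S3; have [_ ? _] := area2_neq S4.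
by split; split=> //; have [_ ? _] := area2_neq S2; rewrite // eq_sym; have [] := area2_neq S2.
Qed.

Lemma flip_sub z : tri (p c) (p a) (p d) z \/ tri (p b) (p c) (p d) z ->
  tri (p a) (p b) (p c) z \/ tri (p b) (p a) (p d) z.
Proof. exact: quad_cover. Qed.

Lemma flip_sup z : tri (p a) (p b) (p c) z \/ tri (p b) (p a) (p d) z ->
  tri (p c) (p a) (p d) z \/ tri (p b) (p c) (p d) z.
Proof.
move=> H; have [h1 _] := pos3; have [_ h2] := pos4; have [_ h3] := pos2.
have [_ h4] := pos1.
have [] := @quad_cover _ (p c) (p d) (p b) (p a) z h1 h2 h3 _.
- by have [] := pos1.
- by case: H => h; [left; apply: tri_rot|right; do 2 apply: tri_rot]; exact: h.
- by move=> h; right; do 2 apply: tri_rot; exact: h.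
- by move=> h; left; apply: tri_rot; exact: h.
Qed.

(** The crossing of the diagonals is interior to [D], so neither of them is a side of the
    polygon. *)
Let crossing : exists z, [/\ seg (p a) (p b) z, seg (p c) (p d) z & nbhs z D].
Proof.
(* Along [cd] the area relative to [ab] goes from [o a b c] to [- o b a d]; it vanishes at this
   parameter. *)
pose s := o a b c / (o a b c + o b a d); pose z := step (p c) (towards (p c) (p d)) s.
have S12 : 0 < o a b c + o b a d by rewrite addr_gt0.
have s0 : 0 < s by rewrite divr_gt0.
have s1 : s < 1 by rewrite ltr_pdivrMr // mul1r ltrDl.
have z1 : area2 (p a) (p b) z = 0.
  rewrite area2_towards (_ : o a b d = - o b a d); last by rewrite area2_swap.
  by rewrite /s; field; rewrite gt_eqF.
have z2 : 0 < area2 (p b) (p c) z by rewrite area2_towards area2E mulr0 add0r mulr_gt0.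
have z3 : 0 < area2 (p c) (p a) z by rewrite area2_towards area2E mulr0 add0r mulr_gt0.
exists z; split; first exact: open_segP z1 z2 z3.
  by apply/segP; exists s; rewrite !ltW.
have [h1 h2] := area2_across (p c) (p d) z1.
have z1' : area2 (p b) (p a) z = 0 by rewrite area2_swap z1 oppr0.
have z2' : 0 < area2 (p a) (p d) z by rewrite -(pmulr_rgt0 _ S1) h1 mulr_gt0.
have z3' : 0 < area2 (p d) (p b) z by rewrite -(pmulr_rgt0 _ S1) h2 mulr_gt0.
have ne : [set a; b; c]%SET <> [set b; a; d]%SET.
  have [[? ? ?] [bd cd ad]] := neqs.
  move=> /setP /(_ d); rewrite !inE eqxx orbT.
  by rewrite ![d == _]eq_sym (negPf ad) (negPf bd) (negPf cd).
by have [] := edge_not_frontier_sides triT tT tT' ne S1 S2 z1 z2 z3 z1' z2' z3'.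
Qed.

Lemma old_diagonal_not_consec : ~ consec a b.
Proof.
have [z [za _ /nbhs_not_frontier nF]] := crossing.
by move=> /(consec_frontier polyP) /(_ za).
Qed.

Lemma new_diagonal_not_consec : ~ consec c d.
Proof.
have [z [_ zc /nbhs_not_frontier nF]] := crossing.
by move=> /(consec_frontier polyP) /(_ zc).
Qed.

(** The labels are ordered as in [flip]; [bad_abd] and [cad_acd] convert them to the
    counterclockwise orders. *)
Definition flipped : {set {set 'I_n}} :=
  ((T :\ [set a; b; c]%SET :\ [set a; b; d]%SET)
    :|: [set [set a; c; d]%SET; [set b; c; d]%SET])%SET.

Let bad_abd : [set a; b; d]%SET = [set b; a; d]%SET.
Proof. exact: set3_swap. Qed.

Let cad_acd : [set a; c; d]%SET = [set c; a; d]%SET.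
Proof. exact: set3_swap. Qed.

Lemma in_flipped t : t \in flipped ->
  [\/ [/\ t \in T, t <> [set a; b; c]%SET & t <> [set b; a; d]%SET],
      t = [set c; a; d]%SET | t = [set b; c; d]%SET].
Proof.
rewrite /flipped bad_abd cad_acd !inE => /orP[/and3P[/eqP h1 /eqP h2 h3]|/orP[]/eqP ->].
- by constructor 1.
- by constructor 2.
- by constructor 3.
Qed.

Lemma flipped_off t z : t \in flipped -> off_lines p z -> triS p t z ->
  tri (p a) (p b) (p c) z \/ tri (p b) (p a) (p d) z ->
  t = [set c; a; d]%SET \/ t = [set b; c; d]%SET.
Proof.
move=> /in_flipped [[h h1 h2]|->|->] off tz; [|by left|by right].
move=> [/(triS_tri _ S1)|/(triS_tri _ S2)] hz.
  by case: h1; exact: triangulation_off off tz hz.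
by case: h2; exact: triangulation_off off tz hz.
Qed.

Lemma flipped_edge t x y : t \in flipped -> x \in t -> y \in t -> x <> y ->
  (exists2 t0, t0 \in T & x \in t0 /\ y \in t0) \/ [set x; y]%SET = [set c; d]%SET.
Proof.
move=> /in_flipped [[h _ _]|->|->]; first by left; exists t.
  rewrite !inE => /orP[/orP[]|] /eqP -> /orP[/orP[]|] /eqP -> // _;
  by [right|right; rewrite finset.setUC|
      left; exists [set a; b; c]%SET; rewrite ?tT // !inE !eqxx ?orbT|
      left; exists [set b; a; d]%SET; rewrite ?tT' // !inE !eqxx ?orbT].
rewrite !inE => /orP[/orP[]|] /eqP -> /orP[/orP[]|] /eqP -> // _;
by [right|right; rewrite finset.setUC|
    left; exists [set a; b; c]%SET; rewrite ?tT // !inE !eqxx ?orbT|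
    left; exists [set b; a; d]%SET; rewrite ?tT' // !inE !eqxx ?orbT].
Qed.

Lemma seg_corner e f g z : 0 < o e f g -> seg (p e) (p f) z -> seg (p e) (p g) z -> z = p e.
Proof.
move=> S0 /area2_seg h1 /area2_seg h2; apply: (@area2_corner _ (p g) _ (p f)) => //.
  by rewrite -area2_rot.
by rewrite area2_swap h2 oppr0.
Qed.

(** The triangle may touch the open quadrilateral only at a boundary point [z] of its own. Moving
    towards its centre and then into general position gives a point off all lines, where two
    distinct triangles of [T] cannot overlap. *)
Lemma quad_strict_flipped t z : t \in flipped -> triS p t z ->
  0 < area2 (p b) (p c) z -> 0 < area2 (p c) (p a) z ->
  0 < area2 (p a) (p d) z -> 0 < area2 (p d) (p b) z ->
  t = [set c; a; d]%SET \/ t = [set b; c; d]%SET.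
Proof.
move=> ht tz z1 z2 z3 z4; case: (in_flipped ht) => [[hT _ _]|->|->]; [|by left|by right].
have [e [f [g [E S0]]]] := triangulation_rep triT hT; subst t.
have [y [y1 y2 y3]] := exists_inside S0.
have /(triP _ S0) [q1 q2 q3] := (triS_tri _ S0).1 tz.
have near_pos i j : 0 < area2 (p i) (p j) z ->
    \forall r \near 0^'+, 0 < area2 (p i) (p j) (step z (towards z y) r).
  by move=> h; exact: (step_near _ (near_area2_gt0 h)).
have H : \forall r \near (0:R)^'+, inside p e f g (step z (towards z y) r) /\
  [/\ 0 < area2 (p b) (p c) (step z (towards z y) r),
   0 < area2 (p c) (p a) (step z (towards z y) r),
   0 < area2 (p a) (p d) (step z (towards z y) r) &
   0 < area2 (p d) (p b) (step z (towards z y) r)].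
  near=> r; split; last by split; near: r; exact: near_pos.
  have r1 : 0 <= 1 - r by rewrite subr_ge0; near: r; exact: nbhs_right_ltW.
  split; rewrite area2_towards; apply: ltr_wpDl; rewrite ?mulr_ge0 //; exact: mulr_gt0.
have [r [ir [r1 r2 r3 r4]]] := @filter_ex _ ((0:R)^'+) _ _ H.
set q := step z (towards z y) r in ir r1 r2 r3 r4.
have U : \forall x \near q, inside p e f g x /\
  [/\ 0 < area2 (p b) (p c) x, 0 < area2 (p c) (p a) x, 0 < area2 (p a) (p d) x &
   0 < area2 (p d) (p b) x].
  have iq := inside_nbhs S0 ir.
  near=> x; split; first by near: x.
  by split; near: x; exact: near_area2_gt0.
have [x [ix [x1 x2 x3 x4]] off] := exists_off_lines (vertex_inj polyP) U.
apply: (flipped_off ht off).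
  by apply/triS_tri => //; exact: inside_tri.
by apply: quad_tri => //; apply: ltW.
Unshelve. all: by end_near. Qed.

(** An interior point of [cd] is strictly inside the quadrilateral, hence only in new triangles,
    whose other edges meet [cd] at corners. If [z] is [p c] or [p d], [edge_vertex] shows that it is
    an end of [xy]. *)
Lemma new_diagonal_meets t x y z : t \in flipped -> x \in t -> y \in t -> x <> y ->
  [set x; y]%SET <> [set c; d]%SET -> seg (p c) (p d) z -> seg (p x) (p y) z ->
  exists w, [/\ w \in [set c; d]%SET, w \in [set x; y]%SET & z = p w].
Proof.
move=> ht hx hy /eqP xy ne zc zx.
have dc : [set d; c]%SET = [set c; d]%SET by rewrite finset.setUC.
have [[h1 h2] [h3 h4]] := (pos3, pos4).
have zc' := seg_sym zc; have zx' := seg_sym zx.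
have new : t = [set c; a; d]%SET \/ t = [set b; c; d]%SET ->
    exists w, [/\ w \in [set c; d]%SET, w \in [set x; y]%SET & z = p w].
  case=> E; subst t; move: hx hy xy ne zx zx'; rewrite !inE.
    move=> /orP[/orP[]|] /eqP -> /orP[/orP[]|] /eqP ->; rewrite ?eqxx ?dc // => _ ne zx zx';
    by [case: ne|exists c; rewrite !inE !eqxx ?orbT; split=> //; apply: (seg_corner S4)|
        exists d; rewrite !inE !eqxx ?orbT; split=> //; apply: (seg_corner h4)].
  move=> /orP[/orP[]|] /eqP -> /orP[/orP[]|] /eqP ->; rewrite ?eqxx ?dc // => _ ne zx zx';
  by [case: ne|exists c; rewrite !inE !eqxx ?orbT; split=> //; apply: (seg_corner h1)|
      exists d; rewrite !inE !eqxx ?orbT; split=> //; apply: (seg_corner h2)].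
case: (in_flipped ht) => [[hT _ _]|h|h]; [|by apply: new; left|by apply: new; right].
have corner w : w \in [set c; d]%SET -> z = p w ->
    exists w, [/\ w \in [set c; d]%SET, w \in [set x; y]%SET & z = p w].
  by move=> hw E; exists w; split=> //; apply: (edge_vertex hT hx hy xy); rewrite -E.
have [s [/andP[s0 s1] E]] := (segP _ _ _).1 zc.
move: s0 s1; rewrite le_eqVlt => /orP[/eqP s0 _|s0].
  by apply: (corner c); rewrite ?inE ?eqxx // E -s0 step0.
rewrite le_eqVlt => /orP[/eqP s1|s1].
  apply: (corner d); rewrite ?inE ?eqxx ?orbT // E s1.
  by rewrite /step /towards /= !mul1r; case: (p c) (p d) => ? ? [? ?] /=; congr pair; ring.
apply: new; apply: (quad_strict_flipped ht (z := z)).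
- have [e [f [g [Et S0]]]] := triangulation_rep triT hT; subst t.
  by apply/triS_tri => //; apply: seg_sub_tri zx => //; exact: corner_tri.
- by rewrite E area2_towards area2E mulr0 add0r mulr_gt0.
- by rewrite E area2_towards area2E mulr0 add0r mulr_gt0.
- by rewrite E area2_towards area2E mulr0 addr0 mulr_gt0 // subr_gt0.
- by rewrite E area2_towards area2E mulr0 addr0 mulr_gt0 // subr_gt0.
Qed.

Hypothesis cd_short : cyl_segment_lift tau (p c) (p d).

Let cad_sub z : tri (p c) (p a) (p d) z -> D z.
Proof.
move=> h; have [h'|h'] := flip_sub (or_introl h).
  exact: (triangulation_sub triT tT S1 h').
exact: (triangulation_sub triT tT' S2 h').
Qed.

Let bcd_sub z : tri (p b) (p c) (p d) z -> D z.
Proof.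
move=> h; have [h'|h'] := flip_sub (or_intror h).
  exact: (triangulation_sub triT tT S1 h').
exact: (triangulation_sub triT tT' S2 h').
Qed.

Lemma new_diagonal_admissible : admissible_diag tau p D c d.
Proof.
have [_ [_ cd _]] := neqs; split=> //; first exact/eqP.
  exact: new_diagonal_not_consec.
by move=> z /seg_tri h; apply: bcd_sub; apply: tri_rot; apply: tri_rot; apply: h.
Qed.

Lemma flipped_diag t x y : t \in flipped -> x \in t -> y \in t -> x <> y ->
  consec x y \/ admissible_diag tau p D x y.
Proof.
move=> ht hx hy xy; have [[t0 h0 [hx0 hy0]]|E] := flipped_edge ht hx hy xy.
  exact: triangulation_diag h0 hx0 hy0 xy.
right; have : x \in [set c; d]%SET by rewrite -E !inE eqxx.
have : y \in [set c; d]%SET by rewrite -E !inE eqxx orbT.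
rewrite !inE => /orP[] /eqP ey /orP[] /eqP ex; subst => //.
- exact: admissible_diag_sym new_diagonal_admissible.
- exact: new_diagonal_admissible.
Qed.

Lemma flipped_triangulation : triangulation tau p D flipped.
Proof.
have mX : [set c; a; d]%SET \in flipped by rewrite /flipped cad_acd !inE eqxx ?orbT.
have mY : [set b; c; d]%SET \in flipped by rewrite /flipped !inE eqxx ?orbT.
have [[nab nbc nca] [nbd ncd nad]] := neqs.
have short e f t : t \in T -> e \in t -> f \in t -> e != f -> cyl_segment_lift tau (p e) (p f).
  exact: triangulation_short.
split.
- move=> t ht; case: (in_flipped ht) => [[h _ _]|E|E].
  + case: triT => H _ _ _ _; have [e [f [g [E [nc [h1 h2 h3 _]]]]]] := H _ h.
    exists e, f, g; split=> //; split=> //; split=> // x y hx hy xy.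
    exact: flipped_diag ht hx hy xy.
  + exists c, a, d; split=> //; split; last split.
    * by apply/eqP; rewrite gt_eqF.
    * by apply: (short _ _ _ tT) => //; rewrite !inE eqxx ?orbT.
    * by apply: (short _ _ _ tT') => //; rewrite !inE eqxx ?orbT.
    * exact: cyl_segment_lift_sym.
    * by move=> x y hx hy xy; apply: flipped_diag ht hx hy xy.
  + exists b, c, d; split=> //; split; last split.
    * by apply/eqP; rewrite gt_eqF.
    * by apply: (short _ _ _ tT) => //; rewrite !inE eqxx ?orbT.
    * by [].
    * by apply: (short _ _ _ tT'); rewrite 1?eq_sym // !inE eqxx ?orbT.
    * by move=> x y hx hy xy; apply: flipped_diag ht hx hy xy.
- move=> t ht z hz; case: (in_flipped ht) => [[h _ _]|E|E].
  + by case: triT => _ H _ _ _; exact: (H _ h).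
  + by apply: cad_sub; apply/(triS_tri _ S4); rewrite -E.
  + by apply: bcd_sub; apply/(triS_tri _ S3); rewrite -E.
- move=> z Dz; case: triT => _ _ H _ _; have [t [ht hz]] := H _ Dz.
  have new : tri (p a) (p b) (p c) z \/ tri (p b) (p a) (p d) z ->
      exists t, t \in flipped /\ triS p t z.
    move=> /flip_sup [h|h].
      by exists [set c; a; d]%SET; split=> //; apply/triS_tri.
    by exists [set b; c; d]%SET; split=> //; apply/triS_tri.
  have [E|/eqP n1] := eqVneq t [set a; b; c]%SET.
    by apply: new; left; apply/triS_tri; rewrite -?E.
  have [E|/eqP n2] := eqVneq t [set b; a; d]%SET.
    by apply: new; right; apply/triS_tri; rewrite -?E.
  exists t; split=> //; rewrite /flipped bad_abd !inE ht.
  by move/eqP: n1 => ->; move/eqP: n2 => ->.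
- move=> t t' ht ht' ne; apply/seteqP; split=> // x0 [h h'].
  have U : nbhs x0 (triS p t `&` triS p t') by exact: filterI.
  (* An overlap of interiors contains a point off all lines; there the old triangles are told apart
     by [triangulation_off], and the two new ones by the line [cd]. *)
  have [x [xt xt'] off] := exists_off_lines (vertex_inj polyP) U; case: ne.
  have new z : triS p [set c; a; d]%SET z \/ triS p [set b; c; d]%SET z ->
      tri (p a) (p b) (p c) z \/ tri (p b) (p a) (p d) z.
    by move=> [/(triS_tri _ S4)|/(triS_tri _ S3)] hz; apply: flip_sub; [left|right].
  have sep : triS p [set c; a; d]%SET x -> triS p [set b; c; d]%SET x -> False.
    move=> /(triS_tri _ S4) /(triP _ S4) [_ _ e1] /(triS_tri _ S3) /(triP _ S3) [_ e2 _].
    have := off c d ncd; rewrite neq_lt ltNge e2 /= ltNge.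
    by rewrite area2_swap oppr_ge0 in e1; rewrite e1.
  have [[hT n1 n2]|E|E] := in_flipped ht; have [[hT' n1' n2']|E'|E'] := in_flipped ht'.
  + exact: triangulation_off hT hT' off xt xt'.
  + by case: (flipped_off ht off xt (new x _)) => //; [left; rewrite -E'|rewrite E'|
      move=> E; case: sep; rewrite -?E -?E'].
  + by case: (flipped_off ht off xt (new x _)) => //; [right; rewrite -E'|
      move=> E; case: sep; rewrite -?E -?E'|rewrite E'].
  + by case: (flipped_off ht' off xt' (new x _)) => //; [left; rewrite -E|rewrite E|
      move=> E'; case: sep; rewrite -?E -?E'].
  + by rewrite E E'.
  + by case: sep; rewrite -?E -?E'.
  + by case: (flipped_off ht' off xt' (new x _)) => //; [right; rewrite -E|
      move=> E'; case: sep; rewrite -?E -?E'|rewrite E].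
  + by case: sep; rewrite -?E -?E'.
  + by rewrite E E'.
- move=> t t' x y x' y' ht ht' hx hy hx' hy' xy xy' nc nc' ne z hz hz'.
  have swap (u v : 'I_n) : [set u; v]%SET = [set c; d]%SET -> seg (p u) (p v) z -> seg (p c) (p d) z.
    move=> E; have : c \in [set u; v]%SET by rewrite E !inE eqxx.
    have : d \in [set u; v]%SET by rewrite E !inE eqxx orbT.
    rewrite !inE => /orP[] /eqP ed /orP[] /eqP ec.
    - by move: ncd; rewrite ec ed eqxx.
    - by rewrite -ed -ec => /seg_sym.
    - by rewrite -ed -ec.
    - by move: ncd; rewrite ec ed eqxx.
  have [[t0 h0 [hx0 hy0]]|E] := flipped_edge ht hx hy xy.
    have [[t1 h1 [hx1 hy1]]|E'] := flipped_edge ht' hx' hy' xy'.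
      by case: triT => _ _ _ _ H; apply: (H t0 t1).
    rewrite E' in ne *.
    have [w [w1 w2 zw]] := new_diagonal_meets ht hx hy xy ne (swap _ _ E' hz') hz.
    by exists w.
  by rewrite E; apply: (new_diagonal_meets ht' hx' hy' xy' _ (swap _ _ E hz) hz') => E'; apply: ne; rewrite E E'.
Qed.

(** Each would overlap [abc] or [bad], which lack [d] or [c] respectively. Hence undoing the flip
    returns exactly [T], and [flipped_sum] counts every triangle once. *)
Lemma new_triangles_notin : [set c; a; d]%SET \notin T /\ [set b; c; d]%SET \notin T.
Proof.
have [[nab nbc nca] [nbd ncd nad]] := neqs.
have no e f g : 0 < o e f g -> c \in [set e; f; g]%SET -> d \in [set e; f; g]%SET ->
    (forall z, tri (p e) (p f) (p g) z -> tri (p a) (p b) (p c) z \/ tri (p b) (p a) (p d) z) ->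
    [set e; f; g]%SET \notin T.
  move=> S0 hc hd sub; apply/negP => hT.
  have [x0 ix0] := exists_inside S0.
  have [x ix off] := exists_off_lines (vertex_inj polyP) (inside_nbhs S0 ix0).
  have xt := inside_tri S0 ix; have xS := (triS_tri _ S0).2 xt.
  case: (sub _ xt) => h.
    have E := triangulation_off hT tT off xS ((triS_tri _ S1).2 h).
    move: hd; rewrite E !inE ![d == _]eq_sym.
    by rewrite (negPf nad) (negPf nbd) (negPf ncd).
  have E := triangulation_off hT tT' off xS ((triS_tri _ S2).2 h).
  move: hc; rewrite E !inE (negPf nca) (negPf ncd) eq_sym (negPf nbc).
  by [].
by split; apply: no => //; try (by rewrite !inE eqxx ?orbT); move=> z h; apply: flip_sub; by [left|right].
Qed.

Lemma flip_flipped : flip tau p D T flipped.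
Proof.
have [_ [_ /eqP ncd _]] := neqs.
split=> //; first exact: flipped_triangulation.
exists a, b, c, d; split; split=> //; first exact: old_diagonal_not_consec.
  by rewrite bad_abd.
move=> z /seg_tri h; have [] := @flip_sub z; first by right; do 2 apply: tri_rot; exact: h.
  by left.
by move=> /tri_swap; right.
Qed.

Lemma flipped_flip : flip tau p D flipped T.
Proof.
have [[/eqP nab _ _] _] := neqs; have [nX nY] := new_triangles_notin.
have cda : [set c; d; a]%SET = [set c; a; d]%SET by rewrite set3_swap -set3_rot -set3_swap set3_rot set3_swap -set3_rot.
have cdb : [set c; d; b]%SET = [set b; c; d]%SET by rewrite -set3_rot.
have cab : [set c; a; b]%SET = [set a; b; c]%SET by rewrite set3_rot.
have dab : [set d; a; b]%SET = [set b; a; d]%SET by rewrite set3_rot set3_swap.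
split=> //; first exact: flipped_triangulation.
exists c, d, a, b; split; split=> //.
- exact: new_diagonal_not_consec.
- by rewrite cda /flipped cad_acd !inE eqxx ?orbT.
- by rewrite cdb /flipped !inE eqxx ?orbT.
- by apply: (triangulation_short tT); rewrite ?inE ?eqxx ?orbT //; apply/eqP.
- move=> z /seg_tri h; have [] := @flip_sup z; first by left.
    by move=> /tri_swap /tri_rot; left.
  by move=> /tri_rot; right.
- rewrite cda cdb cab dab /flipped bad_abd cad_acd; apply/setP => t; rewrite !inE.
  have [->|n1] := eqVneq t [set a; b; c]%SET; first by rewrite tT orbT.
  have [->|n2] := eqVneq t [set b; a; d]%SET; first by rewrite tT' /= orbT.
  have [->|n3] := eqVneq t [set c; a; d]%SET; first by rewrite (negPf nX) ?andbF.
  have [->|n4] := eqVneq t [set b; c; d]%SET; first by rewrite (negPf nY) ?andbF.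
  by rewrite /= !orbF.
Qed.

Lemma flipped_sum (f : {set 'I_n} -> R) :
  \sum_(t in flipped) f t + f [set a; b; c]%SET + f [set b; a; d]%SET =
  \sum_(t in T) f t + f [set c; a; d]%SET + f [set b; c; d]%SET.
Proof.
have [nX nY] := new_triangles_notin; have [[nab nbc nca] [nbd ncd nad]] := neqs.
have neAB : [set b; a; d]%SET \in T :\ [set a; b; c]%SET.
  rewrite !inE tT' andbT; apply/eqP => /setP /(_ d); rewrite !inE eqxx orbT.
  by rewrite ![d == _]eq_sym (negPf nad) (negPf nbd) (negPf ncd).
have neXY : [set c; a; d]%SET != [set b; c; d]%SET.
  apply/eqP => /setP /(_ a); rewrite !inE eqxx orbT /= (negPf nab) (negPf nad).
  by rewrite eq_sym (negPf nca).
rewrite (big_setD1 _ tT) /= (big_setD1 _ neAB) /=.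
have -> : flipped = ([set c; a; d]%SET |:
    ([set b; c; d]%SET |: (T :\ [set a; b; c]%SET :\ [set b; a; d]%SET)))%SET.
  by rewrite /flipped bad_abd cad_acd; apply/setP => t; rewrite !inE orbC orbA.
rewrite big_setU1 /=; last by rewrite !inE negb_or neXY (negPf nX) !andbF.
rewrite big_setU1 /=; last by rewrite !inE (negPf nY) !andbF.
by ring.
Qed.

End OneTriangulation.
End Flip.

(** * Descent by flips to a locally convex triangulation *)

Section Potential.
Variables (R : realType) (tau : R * R) (n : nat) (p : 'I_n -> R * R) (D : set (R * R)).
Implicit Types (a b c d : 'I_n) (T : {set {set 'I_n}}).
Local Notation o a b c := (area2 (p a) (p b) (p c)).

(* The cost of a triangle is six times the integral over it of the linear
   interpolation of W, so flipping an edge that is not locally convex lowers it. *)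
Lemma exists_cost (W : 'I_n -> R) : exists f : {set 'I_n} -> R,
  forall a b c, 0 < o a b c -> f [set a; b; c]%SET = o a b c * (W a + W b + W c).
Proof.
have [t|f Hf] := @choice {set 'I_n} R (fun t r => forall a b c,
    t = [set a; b; c]%SET -> 0 < o a b c -> r = o a b c * (W a + W b + W c)); last first.
  by exists f => a b c; exact: Hf.
have [[a [b [c [-> S0]]]]|no] := pselect (exists a b c, t = [set a; b; c]%SET /\ 0 < o a b c); last first.
  by exists 0 => a b c E S0; case: no; exists a, b, c.
exists (o a b c * (W a + W b + W c)) => a' b' c' E S0'.
have : a' \in [set a; b; c]%SET by rewrite E !inE eqxx.
have : b' \in [set a; b; c]%SET by rewrite E !inE eqxx ?orbT.
have : c' \in [set a; b; c]%SET by rewrite E !inE eqxx ?orbT.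
(* Repeated labels have area zero and odd permutations negative area, so only the cyclic rotations
   remain. *)
move: S0'; rewrite !inE => S0' /orP[/orP[]|] /eqP ec /orP[/orP[]|] /eqP eb /orP[/orP[]|] /eqP ea;
subst a' b' c'; move: S0' S0; rewrite ?area2E ?ltxx // => S0' S0;
first [by []|by rewrite area2_rot; ring|by rewrite -area2_rot; ring|
  by move: S0' S0; rewrite /area2 => ? ?; lra].
Qed.

Hypotheses (tau0 : tau <> (0, 0)) (polyP : cyl_polygon tau p D).

(** There are finitely many sets of triangles, so the descent is replaced by a choice of least cost
    among those reachable from [T0]. Reachability is required in both directions, which provides the
    way back up to [T2]. *)
Lemma flips_to_common T1 T2 : triangulation tau p D T1 -> triangulation tau p D T2 ->
  exists T, clos_refl_trans _ (flip tau p D) T1 T /\ clos_refl_trans _ (flip tau p D) T T2.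
Proof.
have [W [generic cone long]] := exists_weight p tau0.
have [f Hf] := exists_cost W.
have descend T0 : triangulation tau p D T0 -> exists T,
    [/\ triangulation tau p D T, locally_convex p W T,
      clos_refl_trans _ (flip tau p D) T0 T & clos_refl_trans _ (flip tau p D) T T0].
  move=> tri0; pose P T := `[< [/\ triangulation tau p D T,
      clos_refl_trans _ (flip tau p D) T0 T & clos_refl_trans _ (flip tau p D) T T0] >].
  have P0 : P T0 by apply/asboolP; split=> //; exact: rt_refl.
  case: (@arg_minP _ R _ T0 P (fun T => \sum_(t in T) f t) P0) => T /asboolP [triT to from] minT.
  exists T; split=> // a b c d tT tT' S1 S2; rewrite leNgt; apply/negP => neg.
  have S2' : o a b d < 0 by rewrite area2_swap oppr_lt0.
  have [S3 S4] : 0 < o b c d /\ 0 < o c a d.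
    split; rewrite ltNge; apply/negP => h; have := cone a b c d S1 S2';
    by move=> /(_ ltac:(by [left|right])) /(lt_trans neg); rewrite ltxx.
  have [[nab nbc nca] [nbd nda]] : [/\ a != b, b != c & c != a] /\ b != d /\ a != d.
    have [? ? ?] := area2_neq S1; have [_ ? h] := area2_neq S2.
    by split=> //; split=> //; rewrite eq_sym.
  have sh x y t : t \in T -> x \in t -> y \in t -> x != y -> short tau (p x) (p y).
    by move=> ? ? ? ?; apply/(cyl_segment_liftP _ _ tau0); apply: (triangulation_short tau0 triT (t := t)).
  have cd : cyl_segment_lift tau (p c) (p d).
    apply/(cyl_segment_liftP _ _ tau0); apply: contrapT => lcd.
    have : 0 < excess p W a b c d.
      have nac : a != c by rewrite eq_sym.
      by apply: long => //; [apply: (sh _ _ _ tT)|apply: (sh _ _ _ tT')|apply: (sh _ _ _ tT)|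
        apply: (sh _ _ _ tT')]; rewrite // !inE eqxx ?orbT.
    by move=> /(lt_trans neg); rewrite ltxx.
  have ff := flip_flipped tau0 polyP triT tT tT' S1 S2 S3 S4 cd.
  have bf := flipped_flip tau0 polyP triT tT tT' S1 S2 S3 S4 cd.
  have P' : P (flipped T a b c d).
    apply/asboolP; split; first by case: ff.
      by apply: rt_trans to _; exact: rt_step.
    by apply: rt_trans from; exact: rt_step.
  have := minT _ P'; have := flipped_sum polyP triT tT tT' S1 S2 S3 S4 f.
  rewrite !Hf //.
  (* The saving is six times the volume of the tetrahedron between the two lifts of the
     quadrilateral, that is, minus the excess. *)
  have : o a b c * (W a + W b + W c) + o b a d * (W b + W a + W d) - o c a d * (W c + W a + W d)
     - o b c d * (W b + W c + W d) = - excess p W a b c d by rewrite /excess /area2; ring.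
  lra.
move=> /descend [T [triT convT to1 _]] /descend [T' [triT' convT' _ from2]].
exists T; split=> //; suff -> : T = T' by [].
apply/eqP; rewrite finset.eqEsubset.
by rewrite !(locally_convex_sub polyP generic (W := W)).
Qed.

End Potential.

Theorem theorem4p2 (R : realType) (tau : R * R) (htau : tau <> (0%R, 0%R))
  (n : nat) (hn : (4 <= n)%N) (p : 'I_n -> R * R) (D : set (R * R))
  (hP : cyl_polygon tau p D)
  (T1 T2 : {set {set 'I_n}}) :
  triangulation tau p D T1 -> triangulation tau p D T2 ->
  clos_refl_trans _ (flip tau p D) T1 T2.
Proof.
move=> tri1 tri2; have [T [to from]] := flips_to_common htau hP tri1 tri2.
exact: rt_trans to from.
Qed.
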